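(* Let $X=\mathbb T^d$ and $T(x_1,\dots,x_d)=(x_1+\alpha,\,x_2+f_1(x_1),\,\dots,\,x_d+f_{d-1}(x_1,\dots,x_{d-1}))$, where $\alpha$ is irrational and, for $k=1,\dots,d-1$, $f_k:\mathbb T^k\to\mathbb T$ is Lipschitz and for each fixed $(x_1,\dots,x_{k-1})$ the loop $t\mapsto f_k(x_1,\dots,x_{k-1},t)$ is homotopically non-trivial. If $\mu$ is a Borel probability measure on $X$ whose projection onto the first $d-1$ coordinates is absolutely continuous with respect to Haar measure on $\mathbb T^{d-1}$, then every weak$^*$ limit point of $(T^n_*\mu)$ is invariant under the rotations $(x_1,\dots,x_d)\mapsto(x_1,\dots,x_{d-1},x_d+t)$, $t\in\mathbb T$.
   Context: $\mathbb T=\mathbb R/\mathbb Z$. A loop $\mathbb T\to\mathbb T$ is homotopically non-trivial if it has nonzero degree. $T^n_*\mu$ denotes the push-forward of $\mu$ under $T^n$. *)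

(* Defs.v *)
From HB Require Import structures.
From mathcomp Require Import all_boot all_order all_algebra.
From mathcomp Require Import all_classical all_reals all_analysis.
Set Implicit Arguments.
Unset Strict Implicit.
Unset Printing Implicit Defensive.
Import Order.TTheory GRing.Theory Num.Theory.
Import numFieldNormedType.Exports.
Local Open Scope classical_set_scope.
Local Open Scope ring_scope.

(* Conventions.  The circle T = R/Z is represented by real numbers; a point  *)
(* of T^k by a k-tuple of reals (any representative).  Borel sets / Borel    *)
(* probability measures on T^k are represented on the fundamental domain     *)
(* [0,1)^k inside k.-tuple R (which carries the product Borel sigma-algebra  *)
(* of the library, generated by the coordinate projections).                 *)

Section torus.
Variable R : realType.

Definition frac (a : R) : R := a - (Num.floor a)%:~R.

Definition eqZ (a b : R) : Prop := (a - b) \is a Num.int.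

Definition tdist (a b : R) : R := Num.min (frac (a - b)) (1 - frac (a - b)).

Definition tdistn k (x y : k.-tuple R) : R :=
  \big[Num.max/0]_(i < k) tdist (tnth x i) (tnth y i).

Definition torus_map k (f : k.-tuple R -> R) : Prop :=
  forall x y : k.-tuple R, (forall i, eqZ (tnth x i) (tnth y i)) -> eqZ (f x) (f y).

Definition torus_lipschitz k (f : k.-tuple R -> R) : Prop :=
  exists L : R, forall x y : k.-tuple R, tdist (f x) (f y) <= L * tdistn x y.

Definition loop_degree (h : R -> R) (m : int) : Prop :=
  exists H : R -> R, continuous H /\ (forall t, eqZ (H t) (h t)) /\
    H 1 - H 0 = m%:~R.

(* homotopically non-trivial loop = loop of nonzero degree *)
Definition loop_nontrivial (h : R -> R) : Prop :=
  exists m : int, m != 0 /\ loop_degree h m.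


(* the first m coordinates of a tuple (nth with default 0; used for m <= n) *)
Definition prefix m n (x : n.-tuple R) : m.-tuple R := [tuple nth 0 x i | i < m].

(* Here  f k : (k.+1).-tuple R -> R  stands for  f_{k+1} : T^{k+1} -> T.    *)
Definition skew_map d (alpha : R) (f : forall k : nat, k.+1.-tuple R -> R)
  (x : d.-tuple R) : d.-tuple R :=
  [tuple frac (match val i with
               | 0 => nth 0 x 0 + alpha
               | k.+1 => nth 0 x k.+1 + f k (prefix k.+1 x)
               end) | i < d].

Definition rot_last d (t : R) (x : d.-tuple R) : d.-tuple R :=
  [tuple frac (if val i == d.-1 then nth 0 x i + t else nth 0 x i) | i < d].

Definition fund_dom k : set (k.-tuple R) :=
  [set x | forall i : 'I_k, 0 <= tnth x i < 1].

Definition proj_init d (x : d.-tuple R) : (d.-1).-tuple R := prefix d.-1 x.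

Definition box k (a b : k.-tuple R) : set (k.-tuple R) :=
  [set x | forall i : 'I_k, tnth a i <= tnth x i < tnth b i].
Definition box_vol k (a b : k.-tuple R) : R :=
  \prod_(i < k) Num.max 0 (tnth b i - tnth a i).
Definition lebesgue_null k (A : set (k.-tuple R)) : Prop :=
  forall e : R, 0 < e -> exists a b : nat -> k.-tuple R,
    A `<=` \bigcup_n box (a n) (b n) /\
    forall N, \sum_(n < N) box_vol (a n) (b n) <= e.

Definition torus_continuous k (psi : k.-tuple R -> R) : Prop :=
  (forall x y : k.-tuple R, (forall i, eqZ (tnth x i) (tnth y i)) -> psi x = psi y) /\
  (forall (x : k.-tuple R) (e : R), 0 < e -> exists2 del : R, 0 < del &
     forall y : k.-tuple R, (forall i, `|tnth y i - tnth x i| < del) ->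
       `|psi y - psi x| < e).

End torus.

(* Main.v *)
(** Write [T] for the skew product.  If [psi] is Lipschitz and antiperiodic in the last
coordinate ([psi (x + s e_d) = - psi x]), then moving the coordinate [x_(d-1)] by a suitable
[e] of order [1/n] moves the last coordinate of [T^n x] by [s], up to an error governed by the
deviation of a Birkhoff average of the difference quotient of [f_(d-1)] from its mean, which is
proportional to the nonzero degree.  Hence [psi o T^n] at [x + e] is close to [- psi o T^n] at
[x], and [psi o T^n] tends weakly to 0.  The Birkhoff averages converge in [L^2] because weak
decay of correlations on [T^k] gives the mean ergodic theorem on [T^k] by expanding the square,
so that weak decay and ergodicity are obtained together by induction on the dimension.  Since
the [f_k] are only Lipschitz, the difference quotients have to be controlled uniformly in the
step; here one uses that their [L^2] norms increase under refinement of the step.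

Every Lipschitz [F] is, up to a uniformly small error, its mean over the last coordinate plus a
finite sum of antiperiodic functions, so no Fourier analysis is needed.

To pass from Lebesgue measure to [mu], average [psi o T^n] over well chosen times
(Banach-Saks): the averages tend to 0 in [L^2] uniformly in the last coordinate, hence off a
Lebesgue null set of the first [d - 1] coordinates along a subsequence, hence [mu]-almost
everywhere.  So limit points kill all antiperiodic functions.

All functions in play being Lipschitz, integration over the torus is the iterated limit of
Riemann sums. *)

Require Import Defs.
From HB Require Import structures.
From mathcomp Require Import all_boot all_order all_algebra.
From mathcomp Require Import all_classical all_reals all_analysis.
From mathcomp Require Import measurable_realfun.
From mathcomp Require Import zify ring lra.
Set Implicit Arguments.
Unset Strict Implicit.
Unset Printing Implicit Defensive.
Import Order.TTheory GRing.Theory Num.Theory.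
Import numFieldNormedType.Exports.
Local Open Scope classical_set_scope.
Local Open Scope ring_scope.

(** * Distance to the nearest integer, as the metric of R/Z *)

Section circle_distance.
Variable R : realType.
Implicit Types a b : R.

(** The shift that flips the sign of [psi o T^n] has length of order 1/n, so the functions whose
    Birkhoff averages matter change with n, and an ergodic theorem for one function is not enough.
    What saves the argument is that a coarse difference quotient is an average of translates of a
    finer one: the squared norms increase and are bounded, so beyond some step all finer quotients
    are nearly recovered from a single one, whose ergodicity then serves for all of them.

    The second obstacle is [mu], which may be singular along the last coordinate. Decay is therefore
    proved on every section where the last coordinate equals t, at a rate independent of t; this is
    possible because the shift moves an earlier coordinate and its error term depends on the first d
    - 1 coordinates only. Absolute continuity enters only through null sets: no density is formed,
    and exceptional sets are covered by boxes of summable volume. *)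

Definition resZ a : R := a - (Num.floor (a + 2^-1))%:~R.

Definition distZ a : R := `|resZ a|.

Lemma resZ_int a : a - resZ a \is a Num.int.
Proof. by rewrite /resZ opprB addrC subrK intr_int. Qed.

Lemma distZE a : exists2 z : R, z \is a Num.int & distZ a = `|a - z|.
Proof. by exists (Num.floor (a + 2^-1))%:~R => //; exact: intr_int. Qed.

Lemma resZ_itv a : - 2^-1 <= resZ a < 2^-1.
Proof.
rewrite /resZ; have := floor_itv (a + 2^-1).
rewrite intrD; set z := (Num.floor _)%:~R; lra.
Qed.

Lemma distZ_le_half a : distZ a <= 2^-1.
Proof. by rewrite /distZ ler_norml; have := resZ_itv a; lra. Qed.

Lemma int_lt1 a : a \is a Num.int -> `|a| < 1 -> a = 0.
Proof.
move=> /intrP[m ->]; rewrite -intr_norm (_ : 1 = 1%:~R)// ltr_int => h.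
by have -> : m = 0 by lia.
Qed.

Lemma distZ_le_int a z : z \is a Num.int -> distZ a <= `|a - z|.
Proof.
move=> zint; rewrite leNgt; apply/negP => lt1.
have h : `|a - z| < 2^-1 by apply: lt_le_trans lt1 (distZ_le_half a).
have i : z - (a - resZ a) \is a Num.int by rewrite rpredB// resZ_int.
have l : `|z - (a - resZ a)| < 1.
  rewrite ltr_norml; move: h; rewrite ltr_norml; have := resZ_itv a; lra.
have /subr0_eq e := int_lt1 i l.
by move: lt1; rewrite e /distZ opprB addrC subrK ltxx.
Qed.

Lemma distZ_ge0 a : 0 <= distZ a. Proof. exact: normr_ge0. Qed.

Lemma distZ_le_norm a : distZ a <= `|a|.
Proof. by rewrite -{2}(subr0 a) distZ_le_int. Qed.

Lemma distZD a b : distZ (a + b) <= distZ a + distZ b.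
Proof.
have [z zi ->] := distZE a; have [w wi ->] := distZE b.
apply: le_trans (distZ_le_int (a + b) (rpredD zi wi)) _.
by rewrite opprD addrACA ler_normD.
Qed.

Lemma distZN_le a : distZ (- a) <= distZ a.
Proof.
have [z zi ->] := distZE a.
have zi' : - z \is a Num.int by rewrite rpredN.
by apply: le_trans (distZ_le_int (- a) zi') _; rewrite -opprD normrN.
Qed.

Lemma distZN a : distZ (- a) = distZ a.
Proof. by apply/eqP; rewrite eq_le distZN_le -{1}(opprK a) distZN_le. Qed.

Lemma distZ_int a : a \is a Num.int -> distZ a = 0.
Proof.
move=> ai; apply/eqP; rewrite eq_le distZ_ge0 andbT.
by apply: le_trans (distZ_le_int a ai) _; rewrite subrr normr0.
Qed.

Lemma distZ0 : distZ 0 = 0. Proof. by rewrite distZ_int. Qed.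

Lemma distZ_eq0 a : distZ a = 0 -> a \is a Num.int.
Proof. by have [z zi ->] := distZE a => /eqP; rewrite normr_eq0 subr_eq0 => /eqP ->. Qed.

Lemma distZ_eqint a b : a - b \is a Num.int -> distZ a = distZ b.
Proof.
move=> /distZ_int ab0; apply/eqP; rewrite eq_le; apply/andP; split.
  by have := distZD (a - b) b; rewrite subrK ab0 add0r.
by have := distZD (- (a - b)) a; rewrite opprB subrK -[in distZ (b - a)]opprB distZN ab0 add0r.
Qed.

Lemma distZ_distC a b : distZ (a - b) = distZ (b - a).
Proof. by rewrite -opprB distZN. Qed.

Lemma int_eq a b : a - b \is a Num.int -> `|a| + `|b| < 1 -> a = b.
Proof.
move=> i l; apply/subr0_eq/int_lt1 => //; apply: le_lt_trans l; exact: ler_normB.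
Qed.

Lemma frac_itv a : 0 <= Defs.frac a < 1.
Proof.
rewrite /Defs.frac; have := floor_itv a; rewrite intrD; set z := (Num.floor a)%:~R; lra.
Qed.

Lemma frac_int a : a - Defs.frac a \is a Num.int.
Proof. by rewrite /Defs.frac opprB addrC subrK intr_int. Qed.

Lemma frac_id a : 0 <= a < 1 -> Defs.frac a = a.
Proof.
move=> h; apply/eqP; rewrite eq_sym -subr_eq0; apply/eqP/int_lt1; first exact: frac_int.
by rewrite ltr_norml; have := frac_itv a; lra.
Qed.

Lemma tdistE a b : tdist a b = distZ (a - b).
Proof.
rewrite /tdist; set c := a - b.
have fi := frac_int c; have fc := frac_itv c.
rewrite (distZ_eqint fi).
apply/eqP; rewrite eq_le; apply/andP; split.
  have [z /intrP[m ->] ->] := distZE (Defs.frac c).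
  have [m0|m1] := leP m 0.
    rewrite ge_min; apply/orP; left.
    have : m%:~R <= 0 :> R by rewrite -[0]/(0%:~R) ler_int.
    by move=> mR; rewrite ger0_norm; lra.
  rewrite ge_min; apply/orP; right.
  have : 1 <= m%:~R :> R by rewrite -[1]/(1%:~R) ler_int.
  by move=> mR; rewrite ler0_norm; lra.
rewrite le_min; apply/andP; split.
  by apply: le_trans (distZ_le_norm _) _; rewrite ger0_norm; lra.
have i1 : 1 \is a @Num.int R by [].
have := distZ_le_int (Defs.frac c) i1.
by rewrite ler0_norm; lra.
Qed.

End circle_distance.

(** * Means of Lipschitz functions on the circle, as limits of Riemann sums *)

Section circle_mean.
Variable R : realType.
Implicit Types (phi chi : R -> R) (L a b m t : R) (Q K n : nat).

Definition clip L phi := forall a b, `|phi a - phi b| <= L * distZ (a - b).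

Definition rsum phi Q : R := Q%:R^-1 * \sum_(r < Q) phi (r%:R / Q%:R).

(** Asking for a rate O(1/Q) instead of a mere limit lets [mean_uniq] treat sums, multiples and
    shifts by adding up rate constants. The default 0 concerns functions without such a mean. *)
Definition mean phi : R :=
  xget 0 [set m : R | exists C : R, forall Q, (0 < Q)%N -> `|rsum phi Q - m| <= C / Q%:R].

Lemma le_arch a b (C : R) :
  (forall Q, (0 < Q)%N -> a <= b + C / Q%:R) -> a <= b.
Proof.
move=> h; rewrite leNgt; apply/negP => ba.
have d0 : 0 < a - b by lra.
pose Q := (Num.truncn (`|C| / (a - b))).+1.
have Q0 : 0 < Q%:R :> R by rewrite ltr0n.
have : `|C| / (a - b) < Q%:R by rewrite /Q truncnS_gt.
rewrite ltr_pdivrMr// => hQ.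
have := h Q (ltn0Sn _); apply/negP; rewrite -ltNge.
suff : C / Q%:R < a - b by lra.
by rewrite ltr_pdivrMr// mulrC; apply: le_lt_trans hQ; exact: ler_norm.
Qed.

Lemma sum_nat_blocks (V : zmodType) (g : nat -> V) Q K :
  \sum_(j < Q * K) g j = \sum_(r < Q) \sum_(s < K) g (r * K + s)%N.
Proof.
elim: Q => [|Q IH]; first by rewrite mul0n !big_ord0.
rewrite big_ord_recr /= -IH -!(big_mkord xpredT g) -(big_mkord xpredT (fun s => g (Q * K + s)%N)).
rewrite mulSn addnC (@big_cat_nat _ _ _ (Q * K)%N) ?leq_addr//=.
congr (_ + _); rewrite -{1}[(Q * K)%N]add0n big_addn addnC addnK.
by apply: eq_bigr => i _; rewrite addnC.
Qed.

Lemma rsum_dist phi chi Q (B : R) : (0 < Q)%N ->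
  (forall r : nat, `|phi (r%:R / Q%:R) - chi (r%:R / Q%:R)| <= B) ->
  `|rsum phi Q - rsum chi Q| <= B.
Proof.
move=> Q0 h; have QR : 0 < Q%:R :> R by rewrite ltr0n.
rewrite /rsum -mulrBr -sumrB normrM ger0_norm ?invr_ge0 ?ler0n// ler_pdivrMl//.
apply: le_trans (ler_norm_sum _ _ _) _.
apply: le_trans (_ : \sum_(r < Q) B <= _); first by apply: ler_sum => r _; exact: h.
by rewrite sumr_const card_ord mulr_natl.
Qed.

Lemma rsum_refine L phi Q K : 0 <= L -> clip L phi -> (0 < Q)%N -> (0 < K)%N ->
  `|rsum phi Q - rsum phi (Q * K)%N| <= L / Q%:R.
Proof.
move=> L0 hp Q0 K0.
have QR : 0 < Q%:R :> R by rewrite ltr0n.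
have KR : 0 < K%:R :> R by rewrite ltr0n.
rewrite /rsum (sum_nat_blocks (fun j => phi (j%:R / (Q * K)%:R))).
rewrite [in X in _ - X * _]natrM invfM -[X in _ - X]mulrA -mulrBr.
rewrite [X in _ - X]mulr_sumr -sumrB normrM ger0_norm ?invr_ge0 ?ler0n//.
rewrite ler_pdivrMl//.
apply: le_trans (ler_norm_sum _ _ _) _.
apply: le_trans (_ : \sum_(r < Q) (L / Q%:R) <= _); last first.
  by rewrite sumr_const card_ord mulr_natl.
apply: ler_sum => r _.
have -> : phi (r%:R / Q%:R) = K%:R^-1 * \sum_(s < K) phi (r%:R / Q%:R).
  by rewrite sumr_const card_ord -[phi _ *+ K]mulr_natr mulrCA mulVf ?mulr1// gt_eqF.
rewrite -mulrBr -sumrB normrM ger0_norm ?invr_ge0 ?ler0n// ler_pdivrMl//.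
apply: le_trans (ler_norm_sum _ _ _) _.
apply: le_trans (_ : \sum_(s < K) (L / Q%:R) <= _); last first.
  by rewrite sumr_const card_ord mulr_natl.
apply: ler_sum => s _; apply: le_trans (hp _ _) _.
apply: ler_wpM2l => //; rewrite distZ_distC.
apply: le_trans (distZ_le_norm _) _.
rewrite natrD !natrM.
have -> : (r%:R * K%:R + s%:R) / (Q%:R * K%:R) - r%:R / Q%:R = s%:R / K%:R / Q%:R :> R.
  by field; rewrite !gt_eqF.
rewrite ger0_norm; last by rewrite !divr_ge0.
rewrite ler_pdivrMr// mulVf ?gt_eqF// ler_pdivrMr// mul1r ler_nat ltnW//.
Qed.

(** Comparison with the common refinement [Q * P] puts every lower bound [rsum phi P - L / P] below
    every upper bound [rsum phi Q + L / Q]; the supremum of the lower bounds lies in between. *)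
Lemma mean_ex L phi : 0 <= L -> clip L phi ->
  exists m, forall Q, (0 < Q)%N -> `|rsum phi Q - m| <= L / Q%:R.
Proof.
move=> L0 hp.
pose S := [set y : R | exists2 Q, (0 < Q)%N & y = rsum phi Q - L / Q%:R].
have ub Q : (0 < Q)%N -> ubound S (rsum phi Q + L / Q%:R).
  move=> Q0 _ [P P0 ->].
  have := rsum_refine L0 hp Q0 P0; have := rsum_refine L0 hp P0 Q0.
  rewrite [(P * Q)%N]mulnC !ler_norml; lra.
exists (sup S) => Q Q0.
have S0 : S !=set0 by exists (rsum phi Q - L / Q%:R); exists Q.
have := ge_sup S0 (ub Q Q0).
have : rsum phi Q - L / Q%:R <= sup S.
  by apply: ub_le_sup; [exists (rsum phi Q + L / Q%:R); exact: ub|exists Q].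
rewrite ler_norml; lra.
Qed.

Lemma mean_uniq phi m (C : R) :
  (forall Q, (0 < Q)%N -> `|rsum phi Q - m| <= C / Q%:R) -> mean phi = m.
Proof.
move=> h; rewrite /mean; case: xgetP => [m' _ [C' h']|/(_ m)[]]; last by exists C.
apply/eqP; rewrite eq_le; apply/andP; split; apply: (@le_arch _ _ (C + C')) => Q Q0;
  have := h Q Q0; have := h' Q Q0; rewrite mulrDl !ler_norml; lra.
Qed.

Lemma meanP L phi : 0 <= L -> clip L phi ->
  forall Q, (0 < Q)%N -> `|rsum phi Q - mean phi| <= L / Q%:R.
Proof.
move=> L0 hp; have [m hm] := mean_ex L0 hp.
by rewrite (mean_uniq hm).
Qed.

Lemma rsumD phi chi Q : rsum (fun t => phi t + chi t) Q = rsum phi Q + rsum chi Q.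
Proof. by rewrite /rsum big_split/= mulrDr. Qed.

Lemma rsumZ c phi Q : rsum (fun t => c * phi t) Q = c * rsum phi Q.
Proof. by rewrite /rsum -mulr_sumr mulrCA. Qed.

Lemma rsum_cst c Q : (0 < Q)%N -> rsum (fun=> c) Q = c.
Proof.
move=> Q0; rewrite /rsum sumr_const card_ord -[c *+ Q]mulr_natr mulrCA mulVf ?mulr1//.
by rewrite pnatr_eq0 -lt0n.
Qed.

Lemma mean_cst c : mean (fun=> c) = c.
Proof. by apply: (@mean_uniq _ _ 0) => Q Q0; rewrite rsum_cst// subrr normr0 mul0r. Qed.

Lemma meanD L L' phi chi : 0 <= L -> 0 <= L' -> clip L phi -> clip L' chi ->
  mean (fun t => phi t + chi t) = mean phi + mean chi.
Proof.
move=> L0 L0' h h'; apply: (@mean_uniq _ _ (L + L')) => Q Q0.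
rewrite rsumD opprD addrACA mulrDl; apply: le_trans (ler_normD _ _) _.
by apply: lerD; apply: meanP.
Qed.

Lemma meanZ L c phi : 0 <= L -> clip L phi ->
  mean (fun t => c * phi t) = c * mean phi.
Proof.
move=> L0 h; apply: (@mean_uniq _ _ (`|c| * L)) => Q Q0.
by rewrite rsumZ -mulrBr normrM -mulrA; apply: ler_wpM2l => //; apply: meanP.
Qed.

Lemma mean_le L L' phi chi : 0 <= L -> 0 <= L' -> clip L phi -> clip L' chi ->
  (forall t, phi t <= chi t) -> mean phi <= mean chi.
Proof.
move=> L0 L0' h h' le; apply: (@le_arch _ _ (L + L')) => Q Q0.
have l : rsum phi Q <= rsum chi Q.
  by apply: ler_wpM2l; [rewrite invr_ge0|apply: ler_sum].
have := meanP L0 h Q0; have := meanP L0' h' Q0; rewrite mulrDl !ler_norml; lra.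
Qed.

Lemma clip_cst c : clip 0 (fun=> c).
Proof. by move=> a b; rewrite subrr normr0 mul0r. Qed.

Lemma mean_dist L L' phi chi (B : R) : 0 <= L -> 0 <= L' -> clip L phi -> clip L' chi ->
  (forall t, `|phi t - chi t| <= B) -> `|mean phi - mean chi| <= B.
Proof.
have h0 L1 L2 p c : 0 <= L1 -> 0 <= L2 -> clip L1 p -> clip L2 c ->
  (forall t, `|p t - c t| <= B) -> mean p <= mean c + B.
  move=> L10 L20 h1 h2 hB.
  rewrite -[X in _ <= _ + X](mean_cst B) -(meanD _ _ h2 (clip_cst B))//.
  apply: (mean_le L10 L20 h1).
    by move=> a b; rewrite opprD addrACA subrr addr0; exact: h2.
  by move=> t; have := hB t; rewrite ler_norml; lra.
move=> L0 L0' h h' hB; rewrite ler_norml.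
have := h0 _ _ _ _ L0 L0' h h' hB.
have := h0 _ _ _ _ L0' L0 h' h (fun t => _ : `|chi t - phi t| <= B).
move=> /(_ (fun t => eq_ind_r (fun z => z <= B) (hB t) (distrC _ _))); lra.
Qed.

Lemma clip_int L phi a b : clip L phi -> a - b \is a Num.int -> phi a = phi b.
Proof.
move=> h /distZ_int ab; apply/subr0_eq/eqP; rewrite -normr_eq0 eq_le normr_ge0 andbT.
by apply: le_trans (h a b) _; rewrite ab mulr0.
Qed.

Lemma rsum_rot L phi Q (p : nat) : clip L phi -> (0 < Q)%N ->
  rsum (fun t => phi (t + p%:R / Q%:R)) Q = rsum phi Q.
Proof.
move=> h Q0; have QR : Q%:R != 0 :> R by rewrite pnatr_eq0 -lt0n.
elim: p => [|p <-]; first by rewrite /rsum; under eq_bigr do rewrite mul0r addr0.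
apply/eqP; rewrite /rsum -subr_eq0 -mulrBr -sumrB.
rewrite (eq_bigr (fun r : 'I_Q => phi ((r.+1)%:R / Q%:R + p%:R / Q%:R) -
   phi ((r : nat)%:R / Q%:R + p%:R / Q%:R))); last first.
  move=> r _; congr (phi _ - _).
  by rewrite -!mulrDl -!natrD addnS addSn.
rewrite -(big_mkord xpredT (fun r => phi (r.+1%:R / Q%:R + p%:R / Q%:R) -
   phi (r%:R / Q%:R + p%:R / Q%:R))) telescope_sumr//.
rewrite (clip_int h (_ : _ - (0%:R / Q%:R + p%:R / Q%:R) \is a Num.int)) ?subrr ?mulr0//.
by rewrite opprD addrACA subrr addr0 divff// mul0r subr0.
Qed.

(** Rounding the shift down to a multiple p / Q costs at most L / Q, and the Riemann sum with Q
    nodes is invariant under the shift by p / Q. *)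
Lemma mean_shift L phi t : 0 <= L -> clip L phi -> mean (fun a => phi (a + t)) = mean phi.
Proof.
move=> L0 h.
have -> : (fun a => phi (a + t)) = (fun a => phi (a + Defs.frac t)).
  apply/funext => a; apply: (clip_int h).
  by rewrite opprD addrACA subrr add0r frac_int.
have /andP[t0 _] := frac_itv t; set u := Defs.frac t in t0 *.
apply: (@mean_uniq _ _ (L + L)) => Q Q0.
have QR : 0 < Q%:R :> R by rewrite ltr0n.
pose p := Num.truncn (u * Q%:R).
have hp : p%:R <= u * Q%:R < p.+1%:R by rewrite truncn_itv// mulr_ge0// ltW.
rewrite -(subrK (rsum phi Q) (rsum _ Q)) -addrA mulrDl.
apply: le_trans (ler_normD _ _) _; apply: lerD; last exact: meanP.
rewrite -(rsum_rot p h Q0); apply: rsum_dist => // r.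
apply: le_trans (h _ _) _; apply: ler_wpM2l => //.
apply: le_trans (distZ_le_norm _) _.
rewrite opprD addrACA subrr add0r ler_norml.
have -> : u - p%:R / Q%:R = (u * Q%:R - p%:R) / Q%:R by field; rewrite gt_eqF.
rewrite ler_pdivlMr// mulNr mulVf ?gt_eqF// ler_pdivrMr// mulVf ?gt_eqF//.
by move: hp; rewrite -natr1; lra.
Qed.

End circle_mean.

(** * Lipschitz functions on the tori of all dimensions *)

Section lipschitz_functions.
Variable R : realType.
Local Notation pt := (nat -> R).
Implicit Types (x y : pt) (F G : pt -> R) (k i n : nat) (s t L : R).

(* Points of the tori of all dimensions are sequences of reals: a function on the k-torus is
   one that depends only on the first k coordinates, modulo 1, which [lip k] implies. *)
Definition upd x k t : pt := fun i => if i == k then t else x i.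

Definition shiftc k s x : pt := upd x k (x k + s).

Definition pdist k x y : R := \sum_(i < k) distZ (x i - y i).

Definition lipc L k F := forall x y, `|F x - F y| <= L * pdist k x y.

Definition lip k F := exists2 L, 0 <= L & lipc L k F.

Lemma upd_eq x k t : upd x k t k = t. Proof. by rewrite /upd eqxx. Qed.

Lemma upd_neq x k t i : i != k -> upd x k t i = x i.
Proof. by rewrite /upd => /negbTE ->. Qed.

Lemma upd_upd x k s t : upd (upd x k s) k t = upd x k t.
Proof. by apply/funext => i; rewrite /upd; case: eqP. Qed.

Lemma upd_id x k : upd x k (x k) = x.
Proof. by apply/funext => i; rewrite /upd; case: eqP => [->|]. Qed.

Lemma updC x k i s t : i != k -> upd (upd x i s) k t = upd (upd x k t) i s.
Proof.
move=> ik; apply/funext => j; rewrite /upd; case: (j =P k) => [->|//].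
by rewrite eq_sym (negbTE ik).
Qed.

Lemma shiftc_upd x k s t : shiftc k s (upd x k t) = upd x k (t + s).
Proof. by rewrite /shiftc upd_eq upd_upd. Qed.

Lemma shiftcD x k s t : shiftc k s (shiftc k t x) = shiftc k (t + s) x.
Proof. by rewrite /shiftc upd_upd upd_eq addrA. Qed.

Lemma shiftc0 x k : shiftc k 0 x = x.
Proof. by rewrite /shiftc addr0 upd_id. Qed.

Lemma shiftc_updC x k i s t : i != k -> shiftc i s (upd x k t) = upd (shiftc i s x) k t.
Proof. by move=> ik; rewrite /shiftc upd_neq// updC// eq_sym. Qed.

Lemma pdist_ge0 k x y : 0 <= pdist k x y.
Proof. by apply: sumr_ge0 => i _; exact: distZ_ge0. Qed.

Lemma pdistS k x y : pdist k.+1 x y = pdist k x y + distZ (x k - y k).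
Proof. by rewrite /pdist big_ord_recr. Qed.

Lemma pdist_le k n x y : (k <= n)%N -> pdist k x y <= pdist n x y.
Proof.
elim: n => [|n IH]; first by rewrite leqn0 => /eqP ->.
rewrite leq_eqVlt => /orP[/eqP ->//|kn].
by apply: le_trans (IH kn) _; rewrite pdistS lerDl distZ_ge0.
Qed.

Lemma pdist_eq0 k x y : (forall i, (i < k)%N -> x i - y i \is a Num.int) -> pdist k x y = 0.
Proof. by move=> h; apply: big1 => i _; apply/distZ_int/h. Qed.

Lemma pdist_leR k x y : pdist k x y <= k%:R.
Proof.
elim: k => [|k IH]; first by rewrite /pdist big_ord0.
rewrite pdistS -natr1; apply: lerD => //; apply: le_trans (distZ_le_half _) _; lra.
Qed.

Lemma eq_pdist k x x' y y' : (forall i, (i < k)%N -> x i = x' i) ->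
  (forall i, (i < k)%N -> y i = y' i) -> pdist k x y = pdist k x' y'.
Proof. by move=> hx hy; apply: eq_bigr => i _; rewrite hx// hy. Qed.

Lemma pdist_upd k x y s t : pdist k.+1 (upd x k s) (upd y k t) = pdist k x y + distZ (s - t).
Proof.
rewrite pdistS !upd_eq; congr (_ + _).
by apply: eq_pdist => i ik; rewrite upd_neq// neq_ltn ik.
Qed.

Lemma lip_bound k F : lip k F -> exists2 C, 0 <= C & forall x, `|F x| <= C.
Proof.
move=> [L L0 h]; exists (`|F (fun=> 0)| + L * k%:R); first by rewrite addr_ge0// mulr_ge0.
move=> x; rewrite -{1}(subrK (F (fun=> 0)) (F x)) addrC.
apply: le_trans (ler_normD _ _) _; rewrite lerD2l.
by apply: le_trans (h _ _) _; rewrite ler_wpM2l// pdist_leR.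
Qed.

Lemma lip_cst k (c : R) : lip k (fun=> c).
Proof. by exists 0 => // x y; rewrite subrr normr0 mul0r. Qed.

Lemma lipD k F G : lip k F -> lip k G -> lip k (fun x => F x + G x).
Proof.
move=> [L L0 h] [M M0 h']; exists (L + M) => [|x y]; first exact: addr_ge0.
rewrite opprD addrACA mulrDl; apply: le_trans (ler_normD _ _) _.
by apply: lerD; [exact: h|exact: h'].
Qed.

Lemma lipM k F G : lip k F -> lip k G -> lip k (fun x => F x * G x).
Proof.
move=> hF hG; have [C C0 bF] := lip_bound hF; have [B B0 bG] := lip_bound hG.
move: hF hG => [L L0 h] [M M0 h']; exists (C * M + B * L) => [|x y].
  by rewrite addr_ge0// mulr_ge0.
have -> : F x * G x - F y * G y = F x * (G x - G y) + G y * (F x - F y) by ring.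
rewrite mulrDl; apply: le_trans (ler_normD _ _) _; rewrite !normrM -!mulrA.
by apply: lerD; apply: ler_pM.
Qed.

Lemma lipZ k (c : R) F : lip k F -> lip k (fun x => c * F x).
Proof. by move=> h; apply: lipM => //; exact: lip_cst. Qed.

Lemma lipN k F : lip k F -> lip k (fun x => - F x).
Proof.
by move=> [L L0 h]; exists L => // x y; rewrite -opprD normrN.
Qed.

Lemma lipB k F G : lip k F -> lip k G -> lip k (fun x => F x - G x).
Proof. by move=> hF hG; apply: lipD => //; exact: lipN. Qed.

Lemma lip_sqr k F : lip k F -> lip k (fun x => F x ^+ 2).
Proof. by move=> h; under eq_fun do rewrite expr2; exact: lipM. Qed.

Lemma lip_norm k F : lip k F -> lip k (fun x => `|F x|).
Proof. by move=> [L L0 h]; exists L => // x y; apply: le_trans (ler_dist_dist _ _) (h _ _). Qed.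

Lemma lip_sum k n (F : nat -> pt -> R) :
  (forall i, (i < n)%N -> lip k (F i)) -> lip k (fun x => \sum_(i < n) F i x).
Proof.
elim: n => [|n IH] h; first by under eq_fun do rewrite big_ord0; exact: lip_cst.
under eq_fun do rewrite big_ord_recr /=.
by apply: lipD; [apply: IH => i ?; apply: h; rewrite ltnS ltnW|exact: h].
Qed.

Lemma lipW k n F : (k <= n)%N -> lip k F -> lip n F.
Proof.
move=> kn [L L0 h]; exists L => // x y.
by apply: le_trans (h _ _) _; rewrite ler_wpM2l// pdist_le.
Qed.

Lemma lip_dep k F x y : lip k F -> (forall i, (i < k)%N -> x i - y i \is a Num.int) -> F x = F y.
Proof.
move=> [L L0 h] xy; apply/subr0_eq/eqP; rewrite -normr_eq0 eq_le normr_ge0 andbT.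
by apply: le_trans (h _ _) _; rewrite pdist_eq0// mulr0.
Qed.

Lemma lip_eq k F x y : lip k F -> (forall i, (i < k)%N -> x i = y i) -> F x = F y.
Proof. by move=> h e; apply: (lip_dep h) => i ik; rewrite e// subrr. Qed.

Lemma lip_upd k F s : lip k.+1 F -> lip k (fun x => F (upd x k s)).
Proof.
move=> [L L0 h]; exists L => // x y; apply: le_trans (h _ _) _.
by rewrite pdist_upd subrr distZ0 addr0.
Qed.

Lemma pdist_sh k i s x y : pdist k (shiftc i s x) (shiftc i s y) = pdist k x y.
Proof.
apply: eq_bigr => j _; rewrite /shiftc /upd; case: eqP => // ->.
by rewrite opprD addrACA subrr addr0.
Qed.

Lemma lip_sh k i s F : lip k F -> lip k (fun x => F (shiftc i s x)).
Proof. by move=> [L L0 h]; exists L => // x y; rewrite -(pdist_sh _ i s). Qed.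

Lemma lipc_clip L k F x : lipc L k.+1 F -> clip L (fun t => F (upd x k t)).
Proof.
move=> h s t; apply: le_trans (h _ _) _.
by rewrite pdist_upd pdist_eq0 ?add0r// => i _; rewrite subrr.
Qed.

End lipschitz_functions.

(** * Haar mean of Lipschitz functions as an iterated circle mean *)

Section torus_mean.
Variable R : realType.
Local Notation pt := (nat -> R).
Implicit Types (x y : pt) (F G : pt -> R) (k i n : nat) (s t L : R).

Definition pmean k F x : R := mean (fun t => F (upd x k t)).

(* Haar mean over the first k coordinates; the value at 0 is irrelevant when [lip k F]. *)
Fixpoint hmean k F : R := if k is j.+1 then hmean j (pmean j F) else F (fun=> 0).

Lemma lipc_pmean L k F : 0 <= L -> lipc L k.+1 F -> lipc L k (pmean k F).
Proof.
move=> L0 h x y; apply: (mean_dist L0 L0 (lipc_clip x h) (lipc_clip y h)) => t.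
by apply: le_trans (h _ _) _; rewrite pdist_upd subrr distZ0 addr0.
Qed.

Lemma lip_pmean k F : lip k.+1 F -> lip k (pmean k F).
Proof. by move=> [L L0 h]; exists L => //; exact: lipc_pmean. Qed.

Lemma hmean_cst k (c : R) : hmean k (fun=> c) = c.
Proof.
elim: k => [//|k IH] /=; rewrite -[RHS]IH; congr hmean.
by apply/funext => x; rewrite /pmean mean_cst.
Qed.

Lemma hmeanD k F G : lip k F -> lip k G -> hmean k (fun x => F x + G x) = hmean k F + hmean k G.
Proof.
elim: k F G => [//|k IH] F G hF hG /=; rewrite -IH; [|exact: lip_pmean..].
congr hmean; apply/funext => x; have [L L0 h] := hF; have [M M0 h'] := hG.
exact: (meanD L0 M0 (lipc_clip x h) (lipc_clip x h')).
Qed.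

Lemma hmeanZ k (c : R) F : lip k F -> hmean k (fun x => c * F x) = c * hmean k F.
Proof.
elim: k F => [//|k IH] F hF /=; rewrite -IH; last exact: lip_pmean.
congr hmean; apply/funext => x; have [L L0 h] := hF.
exact: (meanZ _ L0 (lipc_clip x h)).
Qed.

Lemma hmeanN k F : lip k F -> hmean k (fun x => - F x) = - hmean k F.
Proof.
move=> h; rewrite -mulN1r -hmeanZ//; congr hmean.
by apply/funext => x; rewrite mulN1r.
Qed.

Lemma hmeanB k F G : lip k F -> lip k G -> hmean k (fun x => F x - G x) = hmean k F - hmean k G.
Proof. by move=> hF hG; rewrite hmeanD ?hmeanN//; exact: lipN. Qed.

Lemma hmean_sum k n (F : nat -> pt -> R) : (forall i, (i < n)%N -> lip k (F i)) ->
  hmean k (fun x => \sum_(i < n) F i x) = \sum_(i < n) hmean k (F i).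
Proof.
elim: n => [|n IH] h.
  by under eq_fun do rewrite big_ord0; rewrite hmean_cst big_ord0.
rewrite big_ord_recr -IH /=; last by move=> i ?; apply: h; rewrite ltnS ltnW.
under eq_fun do rewrite big_ord_recr /=.
rewrite hmeanD//; last exact: h.
by apply: lip_sum => i ?; apply: h; rewrite ltnS ltnW.
Qed.

Lemma hmean_le k F G : lip k F -> lip k G -> (forall x, F x <= G x) -> hmean k F <= hmean k G.
Proof.
elim: k F G => [|k IH] F G hF hG le; first exact: le.
apply: IH; [exact: lip_pmean..|] => x.
have [L L0 h] := hF; have [M M0 h'] := hG.
by apply: (mean_le L0 M0 (lipc_clip x h) (lipc_clip x h')) => t; exact: le.
Qed.

Lemma hmean_ge0 k F : lip k F -> (forall x, 0 <= F x) -> 0 <= hmean k F.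
Proof. by move=> h le; rewrite -(hmean_cst k 0); apply: hmean_le => //; exact: lip_cst. Qed.

Lemma hmean_le_cst k F (c : R) : lip k F -> (forall x, F x <= c) -> hmean k F <= c.
Proof. by move=> h le; rewrite -(hmean_cst k c); apply: hmean_le => //; exact: lip_cst. Qed.

Lemma hmean_norm_le k F G : lip k F -> lip k G -> (forall x, `|F x| <= G x) ->
  `|hmean k F| <= hmean k G.
Proof.
move=> hF hG le; rewrite ler_norml -hmeanN//.
apply/andP; split; apply: hmean_le => //; first exact: lipN.
  by move=> x; have := le x; rewrite ler_norml => /andP[].
by move=> x; have := le x; rewrite ler_norml => /andP[].
Qed.

Lemma hmean_norm_le_cst k F (c : R) : lip k F -> (forall x, `|F x| <= c) -> `|hmean k F| <= c.
Proof.
by move=> h le; rewrite -(hmean_cst k c); apply: hmean_norm_le => //; exact: lip_cst.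
Qed.

Lemma pmean_sh k F s : lip k.+1 F -> pmean k (fun x => F (shiftc k s x)) = pmean k F.
Proof.
move=> [L L0 h]; apply/funext => x; rewrite /pmean.
under eq_fun do rewrite shiftc_upd.
exact: (mean_shift s L0 (lipc_clip x h)).
Qed.

Lemma hmean_sh k F s : lip k.+1 F -> hmean k.+1 (fun x => F (shiftc k s x)) = hmean k.+1 F.
Proof. by move=> h /=; rewrite pmean_sh. Qed.

Lemma pmean_lip k F : lip k F -> pmean k F = F.
Proof.
move=> h; apply/funext => x; rewrite /pmean -[RHS]mean_cst; congr mean.
by apply/funext => t; apply: (lip_eq h) => i ik; rewrite upd_neq// neq_ltn ik.
Qed.

Lemma hmean_lift k F : lip k F -> hmean k.+1 F = hmean k F.
Proof. by move=> h /=; rewrite pmean_lip. Qed.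

Lemma pmean_rate L k F x Q : 0 <= L -> lipc L k.+1 F -> (0 < Q)%N ->
  `|Q%:R^-1 * \sum_(r < Q) F (upd x k (r%:R / Q%:R)) - pmean k F x| <= L / Q%:R.
Proof. by move=> L0 h Q0; exact: (meanP L0 (lipc_clip x h)). Qed.

(** A finite form of Fubini: [hmean k.+1] integrates coordinate k first; replacing that inner mean
    by a Riemann sum costs L / Q, and a finite sum commutes with [hmean k]. *)
Lemma hmean_rate L k F Q : 0 <= L -> lipc L k.+1 F -> (0 < Q)%N ->
  `|Q%:R^-1 * \sum_(r < Q) hmean k (fun x => F (upd x k (r%:R / Q%:R))) - hmean k.+1 F|
    <= L / Q%:R.
Proof.
move=> L0 h Q0; have hF : lip k.+1 F by exists L.
have hs r : lip k (fun x => F (upd x k (r%:R / Q%:R))) by exact: lip_upd.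
rewrite -(hmean_sum (F := fun r x => F (upd x k (r%:R / Q%:R))))//.
rewrite -hmeanZ; last exact: (lip_sum (F := fun r x => F (upd x k (r%:R / Q%:R)))).
rewrite /= -hmeanB; last 2 first.
- by apply: lipZ; exact: (lip_sum (F := fun r x => F (upd x k (r%:R / Q%:R)))).
- exact: lip_pmean.
apply: hmean_norm_le_cst => [|x]; last exact: pmean_rate.
apply: lipB; last exact: lip_pmean.
by apply: lipZ; exact: (lip_sum (F := fun r x => F (upd x k (r%:R / Q%:R)))).
Qed.

Lemma hmean_fibre_bound k F (B : R) : lip k.+1 F ->
  (forall s, `|hmean k (fun x => F (upd x k s))| <= B) -> `|hmean k.+1 F| <= B.
Proof.
move=> [L L0 h] hB; apply: (@le_arch _ _ _ L) => Q Q0.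
have QR : 0 < Q%:R :> R by rewrite ltr0n.
have := hmean_rate L0 h Q0.
set S := _ * _ => hS.
have bS : `|S| <= B.
  rewrite /S normrM ger0_norm ?invr_ge0 ?ler0n// ler_pdivrMl//.
  apply: le_trans (ler_norm_sum _ _ _) _.
  apply: le_trans (_ : \sum_(r < Q) B <= _); first by apply: ler_sum => r _; exact: hB.
  by rewrite sumr_const card_ord mulr_natl.
rewrite -[X in `|X|](subrK S) addrC; apply: le_trans (ler_normD _ _) _.
by apply: lerD => //; rewrite distrC.
Qed.

End torus_mean.

(** * Dyadic averaging and the splitting into antiperiodic functions *)

Section antiperiodic_decomposition.
Variable R : realType.
Local Notation pt := (nat -> R).
Implicit Types (x y : pt) (F G : pt -> R) (k i n : nat) (s t L : R).

Definition antiperiodic k s F := forall x, F (shiftc k s x) = - F x.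

Lemma antiperiodicN k s F : antiperiodic k s F -> antiperiodic k (- s) F.
Proof.
by move=> h x; have := h (shiftc k (- s) x); rewrite shiftcD addNr shiftc0 => ->; rewrite opprK.
Qed.

(* [dyad k F i] averages F over the 2^i shifts of coordinate k by multiples of 2^-i, so
   consecutive differences are antiperiodic and the sequence converges to [pmean k F]. *)
Fixpoint dyad k F i : pt -> R :=
  if i is j.+1 then fun x => 2^-1 * (dyad k F j x + dyad k F j (shiftc k (2^-1 ^+ j.+1) x)) else F.

Lemma lipc_dyad L k n F i : lipc L n F -> lipc L n (dyad k F i).
Proof.
move=> h; elim: i => [//|i IH] x y /=.
have h1 := IH x y; have h2 := IH (shiftc k (2^-1 ^+ i.+1) x) (shiftc k (2^-1 ^+ i.+1) y).
rewrite pdist_sh in h2; move: h1 h2; rewrite !ler_norml; lra.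
Qed.

Lemma lip_dyad k n F i : lip n F -> lip n (dyad k F i).
Proof. by move=> [L L0 h]; exists L => //; exact: lipc_dyad. Qed.

Lemma dyad_per k F i x : lip k.+1 F -> dyad k F i (shiftc k (2^-1 ^+ i) x) = dyad k F i x.
Proof.
move=> h; elim: i x => [|i IH] x /=.
  apply: (lip_dep h) => j _; rewrite /shiftc /upd expr0; case: eqP => [->|_]; last by rewrite subrr.
  by rewrite addrAC subrr add0r.
rewrite shiftcD -(IH x); congr (_ * _).
rewrite addrC; congr (dyad _ _ _ (shiftc _ _ _) + _).
by rewrite -mulr2n exprS -mulrnAl -[2^-1 *+ 2]mulr_natr mulVf ?mul1r// pnatr_eq0.
Qed.

(** With a = [dyad k F i] and b its translate, [dyad k F i.+1] is (a + b) / 2. The shift turns a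
    into b and fixes this average, so the difference goes from (a - b) / 2 to (b - a) / 2. *)
Lemma dyad_antiperiodic k F i : lip k.+1 F ->
  antiperiodic k (2^-1 ^+ i.+1) (fun x => dyad k F i x - dyad k F i.+1 x).
Proof.
move=> h x; have := dyad_per i.+1 x h => -> /=.
set a := dyad k F i x; set b := dyad k F i (shiftc _ _ x); lra.
Qed.

Lemma pmean_dyad k F i : lip k.+1 F -> pmean k (dyad k F i) = pmean k F.
Proof.
move=> h; elim: i => [//|i IH]; apply/funext => x.
have [L L0 hi] := lip_dyad k i h.
have hs : lipc L k.+1 (fun y => dyad k F i (shiftc k (2^-1 ^+ i.+1) y)).
  by move=> y z; rewrite -(pdist_sh _ k (2^-1 ^+ i.+1)).
have c1 := lipc_clip x hi; have c2 := lipc_clip x hs.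
have e : mean (fun t => dyad k F i (shiftc k (2^-1 ^+ i.+1) (upd x k t))) = pmean k F x.
  by rewrite -IH -(pmean_sh (2^-1 ^+ i.+1) (lip_dyad k i h)).
rewrite {1}/pmean /= (@meanZ _ (L + L)) ?addr_ge0//; last first.
  by move=> a b; rewrite opprD addrACA mulrDl; apply: le_trans (ler_normD _ _) _; apply: lerD.
rewrite (meanD L0 L0 c1 c2) e.
by rewrite [mean _](_ : _ = pmean k F x); [lra|rewrite -IH].
Qed.

(** Having period 2^-i in coordinate k and Lipschitz constant L, [dyad k F i] varies along that
    coordinate by at most L 2^-i, and its mean there is that of F. *)
Lemma dyad_close L k F i x : 0 <= L -> lipc L k.+1 F ->
  `|dyad k F i x - pmean k F x| <= L * 2^-1 ^+ i.
Proof.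
move=> L0 h; have hF : lip k.+1 F by exists L.
have hd := @lipc_dyad _ k _ _ i h.
rewrite -(pmean_dyad i hF) -(mean_cst (dyad k F i x)).
have cd := lipc_clip x hd.
apply: (mean_dist (lexx 0) L0 (clip_cst _) cd) => t.
set s := 2^-1 ^+ i; have s0 : 0 < s by rewrite exprn_gt0// invr_gt0.
rewrite -{1}(upd_id x k); set phi := fun t => dyad k F i (upd x k t).
have per u (p : nat) : phi (u + p%:R * s) = phi u.
  elim: p => [|p IH]; first by rewrite mul0r addr0.
  rewrite -IH /phi -natr1 mulrDl mul1r addrA -shiftc_upd; exact: dyad_per.
set u := Defs.frac (t - x k); have /andP[u0 _] := frac_itv (t - x k).
have -> : dyad k F i (upd x k t) = phi (x k + u).
  by apply: (clip_int cd); rewrite opprD addrA frac_int.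
pose p := Num.truncn (u / s).
have /andP[p1 p2] : p%:R <= u / s < p.+1%:R by rewrite truncn_itv// divr_ge0// ltW.
rewrite -(subrK (p%:R * s) u) addrA per.
apply: le_trans (cd _ _) _; rewrite ler_wpM2l//.
apply: le_trans (distZ_le_norm _) _.
rewrite opprD addrA subrr add0r normrN ger0_norm.
  by move: p2; rewrite ltr_pdivrMr// -natr1 mulrDl mul1r => ?; lra.
by move: p1; rewrite ler_pdivlMr// => ?; lra.
Qed.

End antiperiodic_decomposition.

(** * The skew product on sequences of reals and its invariance of Haar mean *)

Section triangular_data.
Variable R : realType.

Definition triangular (g : nat -> (nat -> R) -> R) :=
  forall i x y, (forall l, (l <= i)%N -> x l = y l) -> g i x = g i y.

Definition tri_lip d (g : nat -> (nat -> R) -> R) := forall i, (i.+1 < d)%N ->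
  exists2 L, 0 <= L & forall x y, distZ (g i x - g i y) <= L * pdist i.+1 x y.

End triangular_data.

Section skew_product.
Variables (R : realType) (d : nat) (alpha : R) (g : nat -> (nat -> R) -> R).
Local Notation pt := (nat -> R).
Implicit Types (x y : pt) (F G psi : pt -> R) (k i j n : nat) (s t L : R).

Hypothesis gdep : triangular g.
Hypothesis glip : tri_lip d g.

(** Nothing is reduced modulo 1, so iterates are plain sums of reals; [iter_skew_map_int] compares
    them with the iterates of [skew_map]. *)
Definition skewp x : pt := fun i => if i is j.+1 then x j.+1 + g j x else x 0%N + alpha.
Local Notation T := skewp.

Lemma pdist_skewp k : (k <= d)%N ->
  exists2 M, 0 <= M & forall x y, pdist k (T x) (T y) <= M * pdist k x y.
Proof.
elim: k => [|k IH] kd; first by exists 0 => // x y; rewrite /pdist !big_ord0 mulr0.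
have [M M0 hM] := IH (ltnW kd).
have [L L0 hL] : exists2 L, 0 <= L & forall x y,
    distZ (T x k - T y k) <= distZ (x k - y k) + L * pdist k x y.
  case: k kd {IH hM} => [|k] kd /=.
    by exists 0 => // x y; rewrite mul0r addr0 opprD addrACA subrr addr0.
  have [L L0 hL] := glip kd; exists L => // x y.
  rewrite opprD addrACA; apply: le_trans (distZD _ _) _; rewrite lerD2l; exact: hL.
exists (M + L + 1) => [|x y]; first by rewrite !addr_ge0.
rewrite !pdistS; have := hM x y; have := hL x y; have := pdist_ge0 k x y.
have := distZ_ge0 (x k - y k); set a := distZ (x k - y k); set b := pdist k x y => a0 b0 h1 h2.
have : 0 <= (M + L) * a by rewrite mulr_ge0// addr_ge0.
lra.
Qed.

Lemma lip_skewp k F : (k <= d)%N -> lip k F -> lip k (fun x => F (T x)).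
Proof.
move=> kd [L L0 h]; have [M M0 hM] := pdist_skewp kd.
exists (L * M) => [|x y]; first exact: mulr_ge0.
by apply: le_trans (h _ _) _; rewrite -mulrA ler_wpM2l.
Qed.

Lemma lip_iter k F n : (k <= d)%N -> lip k F -> lip k (fun x => F (iter n T x)).
Proof.
move=> kd h; elim: n => [//|n IH].
by under eq_fun do rewrite iterSr; exact: (lip_skewp kd IH).
Qed.

Lemma skewp_eq k x y : (forall i, (i < k)%N -> x i = y i) ->
  forall i, (i < k)%N -> T x i = T y i.
Proof.
move=> h [|i] ik /=; first by rewrite h.
rewrite h//; congr (_ + _); apply: gdep => l li; apply: h; apply: leq_ltn_trans ik; exact: ltnW.
Qed.

(** The term that T adds to coordinate k depends on lower coordinates only, so T rotates the circles
    of coordinate k. Invariance of Haar mean and commutation with [shiftc] both rest on this. *)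
Lemma skewp_upd k x t i : (i < k.+1)%N ->
  T (upd x k t) i = upd (T x) k (t + (T x k - x k)) i.
Proof.
rewrite ltnS leq_eqVlt => /orP[/eqP ->|ik].
  rewrite upd_eq; case: k => [|k] /=; first by rewrite upd_eq addrAC subrr add0r.
  rewrite upd_eq addrAC subrr add0r; congr (_ + _); apply: gdep => l lk.
  by rewrite upd_neq// neq_ltn ltnS lk.
rewrite [RHS]upd_neq ?neq_ltn ?ik//; apply: (@skewp_eq k) => // l lk.
by rewrite upd_neq// neq_ltn lk.
Qed.

Lemma pmean_skewp k F : (k < d)%N -> lip k.+1 F ->
  pmean k (fun x => F (T x)) = (fun x => pmean k F (T x)).
Proof.
move=> kd hF; apply/funext => x; rewrite /pmean.
have [L L0 h] := hF.
rewrite -(mean_shift (T x k - x k) L0 (lipc_clip (T x) h)); congr mean.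
by apply/funext => t; apply: (lip_eq hF) => i; exact: skewp_upd.
Qed.

Lemma hmean_skewp k F : (k <= d)%N -> lip k F -> hmean k (fun x => F (T x)) = hmean k F.
Proof.
elim: k F => [|k IH] F kd h /=; first exact: (lip_eq h).
rewrite (pmean_skewp kd h); apply: IH; [exact: ltnW|exact: lip_pmean].
Qed.

Lemma hmean_iter k F n : (k <= d)%N -> lip k F -> hmean k (fun x => F (iter n T x)) = hmean k F.
Proof.
move=> kd h; elim: n => [//|n IH]; rewrite -IH.
under eq_fun do rewrite iterSr.
exact: (hmean_skewp kd (lip_iter n kd h)).
Qed.

Definition birkhoff n F x : R := n%:R^-1 * \sum_(j < n) F (iter j T x).

Lemma lip_avg k n F : (k <= d)%N -> lip k F -> lip k (birkhoff n F).
Proof.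
move=> kd h; apply: lipZ; apply: (lip_sum (F := fun j x => F (iter j T x))) => j _.
exact: lip_iter.
Qed.

Lemma lip_avg2 k n F : (k <= d)%N -> lip k F -> lip k (fun x => birkhoff n F x ^+ 2).
Proof. by move=> kd h; apply/lip_sqr/lip_avg. Qed.

Lemma avgD n F G x : birkhoff n (fun x => F x + G x) x = birkhoff n F x + birkhoff n G x.
Proof. by rewrite /birkhoff big_split /= mulrDr. Qed.

End skew_product.

(** * Mean ergodic theorem: closure properties and passage from decay of correlations *)

Section square_means.
Variable R : realType.

(** The difference of the two sides is the variance of the values [a j]. *)
Lemma sqr_mean_le n (a : nat -> R) :
  (n%:R^-1 * \sum_(j < n) a j) ^+ 2 <= n%:R^-1 * \sum_(j < n) a j ^+ 2.
Proof.
case: n => [|n]; first by rewrite !big_ord0 !mulr0 expr0n.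
have N0 : 0 < n.+1%:R :> R by rewrite ltr0n.
set m := _ * _; have hm : n.+1%:R * m = \sum_(j < n.+1) a j.
  by rewrite /m mulrA mulfV ?mul1r// gt_eqF.
have : 0 <= n.+1%:R^-1 * \sum_(j < n.+1) (a j - m) ^+ 2.
  by rewrite mulr_ge0 ?invr_ge0 ?ler0n// sumr_ge0// => j _; exact: sqr_ge0.
have -> : \sum_(j < n.+1) (a j - m) ^+ 2 = \sum_(j < n.+1) a j ^+ 2 - n.+1%:R * m ^+ 2.
  rewrite (eq_bigr (fun j : 'I_n.+1 => a j ^+ 2 - 2 * m * a j + m ^+ 2)); last first.
    by move=> j _; ring.
  rewrite big_split sumrB /= -mulr_sumr -hm sumr_const card_ord -[m ^+ 2 *+ _]mulr_natl; ring.
by rewrite mulrBr mulKf ?gt_eqF// subr_ge0.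
Qed.

End square_means.

Section mean_ergodicity.
Variables (R : realType) (d : nat) (alpha : R) (g : nat -> (nat -> R) -> R).
Local Notation pt := (nat -> R).
Implicit Types (x y : pt) (F G psi : pt -> R) (k i j n : nat) (s t L : R).

Hypothesis gdep : triangular g.
Hypothesis glip : tri_lip d g.

Local Notation T := (skewp alpha g).
Local Notation avg := (birkhoff alpha g).

(** The conclusion of the mean ergodic theorem on the k-torus for a function of mean zero: Birkhoff
    averages tend to 0 in L^2. *)
Definition erg k F := forall e : R, 0 < e ->
  exists N, forall n, (N <= n)%N -> hmean k (fun x => avg n F x ^+ 2) <= e.

Lemma sqrD_le (a b : R) : (a + b) ^+ 2 <= 2 * a ^+ 2 + 2 * b ^+ 2.
Proof.
rewrite -subr_ge0 (_ : _ - _ = (a - b) ^+ 2); [exact: sqr_ge0|ring].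
Qed.

Lemma hmean_sqrD_le k F G : lip k F -> lip k G ->
  hmean k (fun x => (F x + G x) ^+ 2) <=
    2 * hmean k (fun x => F x ^+ 2) + 2 * hmean k (fun x => G x ^+ 2).
Proof.
move=> hF hG; have F2 := lip_sqr hF; have G2 := lip_sqr hG.
rewrite -(hmeanZ _ F2) -(hmeanZ _ G2) -hmeanD; [|exact: lipZ..].
apply: hmean_le => [||x]; last exact: sqrD_le.
- exact/lip_sqr/lipD.
- by apply: lipD; exact: lipZ.
Qed.

Lemma hmean_avg_sqr_le k n F : (k <= d)%N -> lip k F ->
  hmean k (fun x => avg n F x ^+ 2) <= hmean k (fun x => F x ^+ 2).
Proof.
move=> kd h; have F2 := lip_sqr h.
have hi j : lip k (fun x => F (iter j T x) ^+ 2) by exact: (lip_iter alpha glip j kd F2).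
case: n => [|n].
  rewrite [X in hmean _ X](_ : _ = fun=> 0); last first.
    by apply/funext => x; rewrite /birkhoff big_ord0 mulr0 expr0n.
  by rewrite hmean_cst; apply: hmean_ge0 => // x; exact: sqr_ge0.
apply: le_trans (_ : hmean k (fun x => n.+1%:R^-1 * \sum_(j < n.+1) F (iter j T x) ^+ 2) <= _).
  apply: hmean_le => [||x]; first exact: (lip_avg2 _ glip).
    by apply: lipZ; exact: (lip_sum (F := fun j x => F (iter j T x) ^+ 2)).
  exact: (sqr_mean_le n.+1 (fun j => F (iter j T x))).
rewrite hmeanZ; last exact: (lip_sum (F := fun j x => F (iter j T x) ^+ 2)).
rewrite (hmean_sum (F := fun j x => F (iter j T x) ^+ 2))//.
under eq_bigr do rewrite (hmean_iter alpha gdep glip _ kd F2).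
by rewrite sumr_const card_ord -[hmean _ _ *+ _]mulr_natl mulKf// pnatr_eq0.
Qed.

Lemma ergD k F G : (k <= d)%N -> lip k F -> lip k G -> erg k F -> erg k G ->
  erg k (fun x => F x + G x).
Proof.
move=> kd hF hG eF eG e e0; have e4 : 0 < e / 4 by rewrite divr_gt0.
have [N1 h1] := eF _ e4; have [N2 h2] := eG _ e4.
exists (maxn N1 N2) => n; rewrite geq_max => /andP[n1 n2].
under eq_fun do rewrite avgD.
apply: le_trans (hmean_sqrD_le _ _) _; [exact: (lip_avg _ glip)..|].
have := h1 n n1; have := h2 n n2; lra.
Qed.

(** Birkhoff averaging contracts the L^2 norm, so a uniform error in F is never amplified. *)
Lemma erg_approx k F : (k <= d)%N -> lip k F ->
  (forall e : R, 0 < e -> exists G, [/\ lip k G, erg k G & forall x, `|F x - G x| <= e]) ->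
  erg k F.
Proof.
(* The minimum with 1 gives [r ^+ 2 <= r], so a uniform error r costs at most e / 4 in mean
   square. *)
move=> kd hF h e e0; pose r := Num.min 1 (e / 4).
have r0 : 0 < r by rewrite lt_min ltr01 divr_gt0.
have [G [hG eG FG]] := h r r0; have [N hN] := eG _ (divr_gt0 e0 (ltr0n R 4)).
exists N => n nN; have hD : lip k (fun x => F x - G x) by exact: lipB.
have -> : (fun x => avg n F x ^+ 2) =
    (fun x => (avg n (fun x => F x - G x) x + avg n G x) ^+ 2).
  apply/funext => x; rewrite -avgD; congr (_ ^+ 2); congr (_ * _).
  by apply: eq_bigr => j _; rewrite subrK.
apply: le_trans (hmean_sqrD_le _ _) _; [exact: (lip_avg _ glip)..|].
have := hmean_avg_sqr_le n kd hD.
have : hmean k (fun x => (F x - G x) ^+ 2) <= e / 4.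
  apply: hmean_le_cst => [|x]; first exact: lip_sqr.
  rewrite -real_normK ?num_real// expr2; have := FG x.
  rewrite /r le_min => /andP[f1 f4].
  by apply: le_trans f4; rewrite ler_piMl.
have := hN n nN; lra.
Qed.

Lemma sum_decay (c : nat -> R) (C e : R) N n : 0 <= e -> 0 <= C -> (forall r, `|c r| <= C) ->
  (forall r, (N <= r)%N -> `|c r| <= e) ->
  \sum_(j < n) `|c j.+1| <= N%:R * C + n%:R * e.
Proof.
move=> e0 C0 cC ce.
suff : \sum_(j < n) `|c j.+1| <= (minn n N)%:R * C + n%:R * e.
  move/le_trans; apply; rewrite lerD2r ler_wpM2r// ler_nat; exact: geq_minr.
elim: n => [|n IH]; first by rewrite big_ord0 min0n !mul0r addr0.
rewrite big_ord_recr /=; have [Nn|nN] := leqP N n.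
  have -> : minn n.+1 N = minn n N by rewrite !(minn_idPr _)// leqW.
  have := ce n.+1 (leqW Nn); rewrite -[n.+1%:R]natr1 mulrDl mul1r; move: IH; lra.
have -> : minn n.+1 N = (minn n N).+1 by rewrite !(minn_idPl _)// ltnW.
have := cC n.+1; rewrite -[n.+1%:R]natr1 -[(minn n N).+1%:R]natr1 !mulrDl !mul1r; move: IH; lra.
Qed.

(** Write S for the Birkhoff sums and W for their mean squares. Since S_(n+1) = psi + S_n o T,
    invariance makes W grow by the diagonal term plus twice the first n correlations, at most K + n
    e. Summing gives n K + n^2 e / 2, which is at most n^2 e for large n. *)
Lemma mixing_erg k psi : (k <= d)%N -> lip k psi ->
  (forall e : R, 0 < e -> exists N, forall n, (N <= n)%N ->
     `|hmean k (fun x => psi x * psi (iter n T x))| <= e) ->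
  erg k psi.
Proof.
move=> kd h mix e e0; have [C C0 bC] := lip_bound h.
have e2 : 0 < e / 2 by rewrite divr_gt0.
have [N hN] := mix _ e2.
pose c r := hmean k (fun x => psi x * psi (iter r T x)).
have hit r : lip k (fun x => psi (iter r T x)) by exact: (lip_iter _ glip).
have hc r : lip k (fun x => psi x * psi (iter r T x)) by exact: lipM.
have CC : 0 <= C * C by exact: mulr_ge0.
have cC r : `|c r| <= C * C.
  by apply: hmean_norm_le_cst => // x; rewrite normrM; apply: ler_pM.
pose S n x := \sum_(j < n) psi (iter j T x).
have hS n : lip k (S n) by exact: (lip_sum (F := fun j x => psi (iter j T x))).
have hS2 n : lip k (fun x => S n x ^+ 2) by exact: lip_sqr.
pose W n := hmean k (fun x => S n x ^+ 2).
pose K := C * C + 2 * (N%:R * (C * C)).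
have step n : W n.+1 <= W n + K + n%:R * e.
  have -> : W n.+1 = c 0%N + 2 * (\sum_(j < n) c j.+1) + W n.
    rewrite -(hmean_sum (F := fun j x => psi x * psi (iter j.+1 T x)))//.
    have hs1 : lip k (fun x => \sum_(j < n) psi x * psi (iter j.+1 T x)).
      exact: (lip_sum (F := fun j x => psi x * psi (iter j.+1 T x))).
    rewrite -hmeanZ// -hmeanD//; last exact: lipZ.
    rewrite /W -(hmean_skewp alpha gdep kd (hS2 n)) -hmeanD; last 2 first.
    - by apply: lipD => //; exact: lipZ.
    - exact: (lip_skewp alpha glip kd (hS2 n)).
    congr hmean; apply/funext => x; rewrite /S big_ord_recl /=.
    rewrite -mulr_sumr.
    rewrite (eq_bigr (fun j : 'I_n => psi (iter j T (T x)))); last first.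
      by move=> j _; rewrite -iterSr.
    rewrite (eq_bigr (fun j : 'I_n => psi (iter j T (T x)))); last first.
      by move=> j _; rewrite -iterSr.
    by set u := \sum_(j < n) _; ring.
  have d1 := sum_decay n (ltW e2) CC cC hN.
  have d2 : \sum_(j < n) c j.+1 <= \sum_(j < n) `|c j.+1|.
    by apply: ler_sum => j _; exact: ler_norm.
  have := le_trans (ler_norm _) (cC 0%N).
  rewrite /K; move: d1 d2; set a := \sum_(j < n) _; set b := \sum_(j < n) _; lra.
have bound n : W n <= n%:R * K + n%:R ^+ 2 * (e / 2).
  elim: n => [|n IH].
    rewrite /W [X in hmean _ X](_ : _ = fun=> 0) ?hmean_cst ?expr0n ?mul0r ?addr0//.
    by apply/funext => x; rewrite /S big_ord0 expr0n.
  apply: le_trans (step n) _; rewrite -natr1.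
  have -> : (n%:R + 1) ^+ 2 = n%:R ^+ 2 + 2 * n%:R + 1 :> R by ring.
  have := IH; rewrite !mulrDl; lra.
pose n0 := (Num.truncn (K / (e / 2))).+1.
exists n0 => n nn0.
have n0R : 0 < n%:R :> R by rewrite ltr0n; apply: leq_trans nn0.
have -> : hmean k (fun x => avg n psi x ^+ 2) = (n%:R^-1) ^+ 2 * W n.
  by rewrite /W -hmeanZ//; congr hmean; apply/funext => x; rewrite -exprMn.
rewrite exprVn ler_pdivrMl ?exprn_gt0//; apply: le_trans (bound n) _.
have : K / (e / 2) <= n%:R.
  apply: le_trans (_ : n0%:R <= _); last by rewrite ler_nat.
  by rewrite ltW// /n0 truncnS_gt.
rewrite ler_pdivrMr// => Kn.
have : n%:R * K <= n%:R * (n%:R * (e / 2)) by rewrite ler_wpM2l// ltW.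
rewrite mulrA -expr2; lra.
Qed.

Lemma erg_step k : (k < d)%N ->
  (forall F, lip k F -> hmean k F = 0 -> erg k F) ->
  (forall psi s, lip k.+1 psi -> antiperiodic k s psi -> erg k.+1 psi) ->
  forall F, lip k.+1 F -> hmean k.+1 F = 0 -> erg k.+1 F.
Proof.
move=> kd ek ea F hF F0.
have hp : lip k (pmean k F) by exact: lip_pmean.
have hp1 : lip k.+1 (pmean k F) by exact: lipW hp.
have ep : erg k.+1 (pmean k F).
  move=> e e0; have [N hN] := ek _ hp F0 _ e0; exists N => n nN.
  rewrite hmean_lift; first exact: hN.
  exact: (lip_avg2 _ glip n (ltnW kd) hp).
have hd i : lip k.+1 (dyad k F i) by exact: lip_dyad.
have ed I : erg k.+1 (fun x => F x - dyad k F I x).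
  elim: I => [|I IH].
    move=> e e0; exists 0%N => n _.
    rewrite [X in hmean _ X](_ : _ = fun=> 0) ?hmean_cst ?ltW//.
    apply/funext => x; rewrite /birkhoff big1 ?mulr0 ?expr0n//.
    by move=> j _; rewrite /= subrr.
  have -> : (fun x => F x - dyad k F I.+1 x) =
      (fun x => (F x - dyad k F I x) + (dyad k F I x - dyad k F I.+1 x)).
    by apply/funext => x; rewrite addrA subrK.
  apply: ergD => //; [exact: lipB..|].
  by apply: ea (dyad_antiperiodic I hF); exact: lipB.
apply: erg_approx => // e e0; have [L L0 hL] := hF.
have [I hI] : exists I, L * 2^-1 ^+ I <= e.
  pose q := (Num.truncn (L / e)).+1; exists q.
  have : L / e < q%:R by rewrite /q truncnS_gt.
  rewrite ltr_pdivrMr// exprVn ler_pdivrMr ?exprn_gt0// => Lq.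
  apply: le_trans (ltW Lq) _; rewrite mulrC ler_wpM2l ?ltW//.
  by rewrite -natrX ltr_nat ltn_expl.
(* The first summand is ergodic as a function on the k-torus, the second as a telescoping sum of
   antiperiodic functions; what is missing from F is [dyad k F I - pmean k F]. *)
exists (fun x => pmean k F x + (F x - dyad k F I x)); split.
- by apply: lipD => //; exact: lipB.
- by apply: ergD => //; exact: lipB.
- move=> x; apply: le_trans hI; apply: le_trans (dyad_close I x L0 hL).
  by rewrite (_ : F x - _ = dyad k F I x - pmean k F x)//; ring.
Qed.

End mean_ergodicity.

(** * Irrational rotation of the circle, the base of the induction *)

Section irrational_rotation.
Variable R : realType.
Implicit Types (alpha s e : R).

(** Dirichlet's pigeonhole principle: two of N + 1 fractional parts fall into the same of N cells.
    Their difference cannot vanish, as alpha would then be rational. *)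
Lemma irrational_approx0 alpha e : irrational alpha -> 0 < e ->
  exists (p : nat) (z : R), z \is a Num.int /\ 0 < `|p%:R * alpha - z| <= e.
Proof.
move=> irr e0; pose N := (Num.truncn (e^-1)).+1.
have NR : 0 < N%:R :> R by rewrite ltr0n.
have Ne : N%:R^-1 < e by rewrite invf_plt// truncnS_gt.
pose fr (j : nat) := Defs.frac (j%:R * alpha).
have cell (j : nat) : (Num.truncn (N%:R * fr j) < N)%N.
  rewrite truncn_lt_nat; last by rewrite mulr_ge0//; case/andP: (frac_itv (j%:R * alpha)).
  by rewrite gtr_pMr//; case/andP: (frac_itv (j%:R * alpha)).
pose b (j : 'I_N.+1) : 'I_N := Ordinal (cell j).
have [j1 [j2 [j12 bj]]] : exists j1 j2 : 'I_N.+1, (j1 < j2)%N /\ b j1 = b j2.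
  have : ~~ injectiveb b.
    by apply/negP => /injectiveP /leq_card; rewrite !card_ord ltnn.
  move=> /injectivePn[j1 [j2 j12 e12]]; have [lt|lt|eq] := ltngtP j1 j2.
  - by exists j1, j2.
  - by exists j2, j1.
  - by move: j12; rewrite (val_inj eq) eqxx.
have close : `|fr j2 - fr j1| <= N%:R^-1.
  have /(congr1 val)/= e12 := bj.
  have i1 : (Num.truncn (N%:R * fr j1))%:R <= N%:R * fr j1 < (Num.truncn (N%:R * fr j1)).+1%:R.
    by rewrite truncn_itv// mulr_ge0//; case/andP: (frac_itv (j1%:R * alpha)).
  have i2 : (Num.truncn (N%:R * fr j2))%:R <= N%:R * fr j2 < (Num.truncn (N%:R * fr j2)).+1%:R.
    by rewrite truncn_itv// mulr_ge0//; case/andP: (frac_itv (j2%:R * alpha)).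
  move: i1 i2; rewrite e12 -natr1; set t := (Num.truncn _)%:R => i1 i2.
  have -> : fr j2 - fr j1 = N%:R^-1 * (N%:R * fr j2 - N%:R * fr j1).
    by rewrite -mulrBr mulKf// gt_eqF.
  rewrite normrM ger0_norm ?invr_ge0 ?ler0n// ler_piMr ?invr_ge0 ?ler0n// ler_norml; lra.
exists (j2 - j1)%N, ((j2%:R * alpha - fr j2) - (j1%:R * alpha - fr j1)); split.
  by rewrite rpredB// frac_int.
have eqz : (j2 - j1)%:R * alpha - (j2%:R * alpha - fr j2 - (j1%:R * alpha - fr j1)) = fr j2 - fr j1.
  by rewrite natrB ?(ltnW j12)//; ring.
rewrite eqz (le_trans close (ltW Ne)) andbT normr_gt0; apply/eqP => f0.
apply: irr; apply/rationalP.
have /intrP[m hm] : (j2%:R * alpha - fr j2) - (j1%:R * alpha - fr j1) \is a Num.int.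
  by rewrite rpredB// frac_int.
exists m, (j2 - j1)%N; rewrite -hm.
have jn0 : (j2 - j1)%:R != 0 :> R by rewrite pnatr_eq0 subn_eq0 -ltnNge.
apply: (mulIf jn0); rewrite divfK// mulrC.
by apply/subr0_eq; rewrite eqz.
Qed.

(** Multiples of a small nonzero c = p alpha - z come within |c| of any point on their side of 0. As
    the sign of c is not controlled, only s or -s is reached, which is enough because antiperiods
    are symmetric. *)
Lemma irrational_dense alpha s e : irrational alpha -> 0 < e ->
  exists q : nat, distZ (q%:R * alpha - s) <= e \/ distZ (q%:R * alpha + s) <= e.
Proof.
move=> irr e0; have [p [z [zi /andP[b0 be]]]] := irrational_approx0 irr e0.
set c := p%:R * alpha - z in b0 be.
pose i := Num.truncn (`|s| / `|c|).
have /andP[i1 i2] : i%:R <= `|s| / `|c| < i.+1%:R by rewrite truncn_itv// divr_ge0.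
rewrite ler_pdivlMr// in i1; rewrite ltr_pdivrMr// -natr1 mulrDl mul1r in i2.
have hc : `| i%:R * `|c| - `|s| | <= e by rewrite ler_norml; lra.
have iz : i%:R * z \is a Num.int by rewrite rpredM ?natr_int.
exists (i * p)%N.
have eqv (t : R) : distZ ((i * p)%:R * alpha + t) <= `|i%:R * c + t|.
  apply: le_trans (distZ_le_int _ iz) _.
  by rewrite (_ : _ - _ = i%:R * c + t)// /c natrM; ring.
have [c0|c0] := leP 0 c; have [s0|s0] := leP 0 s; move: hc;
  rewrite ?(ger0_norm c0) ?(ltr0_norm c0) ?(ger0_norm s0) ?(ltr0_norm s0) => hc.
- by left; apply: le_trans (eqv _) _.
- by right; apply: le_trans (eqv _) _; rewrite opprK in hc.
- right; apply: le_trans (eqv _) _.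
  by rewrite -normrN (_ : - _ = i%:R * - c - s)//; ring.
- left; apply: le_trans (eqv _) _.
  by rewrite -normrN (_ : - _ = i%:R * - c - - s)//; ring.
Qed.

Lemma sum_shift_le (a : nat -> R) (C : R) (n q : nat) : (forall j, `|a j| <= C) ->
  `|\sum_(j < n) a (j + q)%N - \sum_(j < n) a j| <= q%:R * (2 * C).
Proof.
move=> h; elim: q => [|q IH].
  by under eq_bigr do rewrite addn0; rewrite subrr normr0 mul0r.
have e : \sum_(j < n) a (j + q.+1)%N - \sum_(j < n) a (j + q)%N = a (n + q)%N - a q.
  rewrite -sumrB.
  rewrite -(big_mkord xpredT (fun j => a (j + q.+1)%N - a (j + q)%N)).
  under eq_bigr do rewrite addnS -addSn.
  by rewrite (telescope_sumr (fun j => a (j + q)%N))// add0n.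
rewrite -(subrK (\sum_(j < n) a (j + q)%N) (\sum_(j < n) a (j + q.+1)%N)) e -addrA.
apply: le_trans (ler_normD _ _) _; rewrite -natr1 mulrDl mul1r.
by have := ler_normB (a (n + q)%N) (a q); move: IH (h (n + q)%N) (h q); lra.
Qed.

Variables (d : nat) (alpha : R) (g : nat -> (nat -> R) -> R).
Hypothesis glip : tri_lip d g.

Lemma iter_skewp0 n x : iter n (skewp alpha g) x 0%N = x 0%N + n%:R * alpha.
Proof.
elim: n => [|n IH]; first by rewrite mul0r addr0.
by rewrite /= IH -natr1 mulrDl mul1r addrA.
Qed.

(** If q alpha is close to an antiperiod, each [a (j + q) + a j] is small, while moving the
    summation range by q changes the sum by a bounded amount. Hence twice the Birkhoff sum is small
    relative to n, uniformly in x. *)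
Lemma erg_rotation psi s : (0 < d)%N -> irrational alpha ->
  lip 1 psi -> antiperiodic 0 s psi -> erg alpha g 1 psi.
Proof.
move=> d0 irr hpsi anti e e0; have [C C0 bC] := lip_bound hpsi.
have [L L0 hL] := hpsi.
pose r := Num.min 1 e; have r0 : 0 < r by rewrite lt_min ltr01.
have [q [s' anti' hq]] : exists q : nat, exists2 s', antiperiodic 0 s' psi &
    distZ (q%:R * alpha - s') <= r / (L + 1).
  have [|q [h|h]] := @irrational_dense alpha s (r / (L + 1)) irr; first by rewrite divr_gt0// ltr_pwDr.
    by exists q, s.
  by exists q, (- s); [exact: antiperiodicN|rewrite opprK].
pose N := (Num.truncn (q%:R * (2 * C) / r)).+1.
exists N => n nN.
have nR : 0 < n%:R :> R by rewrite ltr0n (leq_trans _ nN).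
have small x : `|birkhoff alpha g n psi x| <= r.
  rewrite /birkhoff normrM ger0_norm ?invr_ge0 ?ler0n// ler_pdivrMl//.
  pose a j := psi (iter j (skewp alpha g) x).
  have h1 := @sum_shift_le a C n q (fun j => bC _).
  have h2 : `|\sum_(j < n) (a (j + q)%N + a j)| <= n%:R * r.
    apply: le_trans (ler_norm_sum _ _ _) _.
    apply: le_trans (_ : \sum_(j < n) r <= _); last by rewrite sumr_const card_ord mulr_natl.
    apply: ler_sum => j _; rewrite /a -[X in _ + X]opprK -anti'.
    apply: le_trans (hL _ _) _.
    rewrite /pdist big_ord1 iter_skewp0 /shiftc upd_eq iter_skewp0 natrD.
    rewrite (_ : _ - _ = q%:R * alpha - s'); last by ring.
    apply: le_trans (_ : L * (r / (L + 1)) <= _); first by rewrite ler_wpM2l.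
    rewrite mulrA ler_pdivrMr ?ltr_pwDr//; lra.
  have h3 : q%:R * (2 * C) <= n%:R * r.
    rewrite -ler_pdivrMr//; apply: le_trans (_ : N%:R <= _); last by rewrite ler_nat.
    by rewrite ltW// /N truncnS_gt.
  move: h1 h2; rewrite big_split /= -/(a _); set u := \sum_(j < n) a (j + q)%N.
  rewrite -[\sum_(j < n) psi _]/(\sum_(j < n) a j); set v := \sum_(j < n) a j.
  rewrite !ler_norml; lra.
apply: hmean_le_cst => [|x]; first exact: (lip_avg2 _ glip).
rewrite -real_normK ?num_real// expr2; have := small x; rewrite /r le_min => /andP[f1 f4].
by apply: le_trans f4; rewrite ler_piMl.
Qed.

End irrational_rotation.

(** * Difference quotients along one coordinate and their mean, the degree *)

Section fibre_increments.
Variables (R : realType) (f : (nat -> R) -> R) (j : nat) (L : R).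
Local Notation pt := (nat -> R).
Implicit Types (x y : pt) (s t : R) (r n N K : nat).

Hypothesis L0 : 0 <= L.
Hypothesis hf : forall x y, distZ (f x - f y) <= L * pdist j.+1 x y.

Lemma eq_int (a b : R) : a \is a Num.int -> a = b -> b \is a Num.int.
Proof. by move=> + <-. Qed.

Lemma resZ_small (a : R) : `|a| < 2^-1 -> resZ a = a.
Proof.
move=> h; apply/esym/int_eq; first exact: resZ_int.
by have := distZ_le_half a; rewrite -/(distZ a); lra.
Qed.

Lemma distZ_small (a : R) : `|a| < 2^-1 -> distZ a = `|a|.
Proof. by rewrite /distZ => /resZ_small ->. Qed.

(** For small s this is the increment of a continuous lift of f along coordinate j, obtained without
    choosing a lift. *)
Definition incr s x : R := resZ (f (shiftc j s x) - f x).

Lemma pdist_sh_id s t x : pdist j.+1 (shiftc j s x) (shiftc j t x) = distZ (s - t).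
Proof.
by rewrite /shiftc pdist_upd pdist_eq0 ?add0r 1?opprD 1?addrACA 1?subrr ?add0r// => i _; rewrite subrr.
Qed.

Lemma incr_int s x : (f (shiftc j s x) - f x) - incr s x \is a Num.int.
Proof. exact: resZ_int. Qed.

Lemma incr_le s x : `|incr s x| <= L * `|s|.
Proof.
apply: le_trans (hf _ _) _; rewrite ler_wpM2l//.
by rewrite -{2}(shiftc0 x j) pdist_sh_id subr0 distZ_le_norm.
Qed.

(** Residues jump at half-integers, but two increments of size at most 1/8 differ by less than 1/2.
    Their difference is its own residue, so the Lipschitz bound modulo 1 becomes a bound in R. *)
Lemma incr_lip s x y : L * `|s| <= 8^-1 ->
  `|incr s x - incr s y| <= (L + L) * pdist j.+1 x y.
Proof.
move=> hs; have hx := le_trans (incr_le s x) hs; have hy := le_trans (incr_le s y) hs.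
rewrite -distZ_small; last first.
  by apply: le_lt_trans (ler_normB _ _) _; move: hx hy; lra.
have -> : distZ (incr s x - incr s y) = distZ ((f (shiftc j s x) - f (shiftc j s y)) - (f x - f y)).
  by apply/esym/distZ_eqint/(eq_int (rpredB (incr_int s x) (incr_int s y))); ring.
apply: le_trans (distZD _ _) _; rewrite distZN mulrDl; apply: lerD; last exact: hf.
by rewrite -(pdist_sh j.+1 j s).
Qed.

(** Both sides agree modulo 1 by telescoping and are at most 1/8 in absolute value, hence they are
    equal. *)
Lemma incr_add s x K : L * (K%:R * `|s|) <= 8^-1 ->
  incr (K%:R * s) x = \sum_(r < K) incr s (shiftc j (r%:R * s) x).
Proof.
move=> hs; apply: int_eq.
  suff : f (shiftc j (K%:R * s) x) - f x - \sum_(r < K) incr s (shiftc j (r%:R * s) x) \is a Num.int.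
    by move=> h; apply: (eq_int (rpredB h (incr_int (K%:R * s) x))); ring.
  elim: K {hs} => [|K IH]; first by rewrite big_ord0 mul0r shiftc0 subrr subr0.
  rewrite big_ord_recr /=; apply: (eq_int (rpredD IH (incr_int s (shiftc j (K%:R * s) x)))).
  by rewrite shiftcD -natr1 mulrDl mul1r; ring.
have h1 : `|incr (K%:R * s) x| <= 8^-1.
  by apply: le_trans (incr_le _ _) _; rewrite normrM normr_nat.
have h2 : `|\sum_(r < K) incr s (shiftc j (r%:R * s) x)| <= 8^-1.
  apply: le_trans (ler_norm_sum _ _ _) _.
  apply: le_trans (_ : \sum_(r < K) (L * `|s|) <= _); first by apply: ler_sum => r _; exact: incr_le.
  by rewrite sumr_const card_ord -[_ *+ K]mulr_natl mulrCA.
lra.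
Qed.

Variable Q : nat.
Hypothesis Q0 : (0 < Q)%N.
Hypothesis LQ : 8 * L <= Q%:R.

Let QR : 0 < Q%:R :> R. Proof. by rewrite ltr0n. Qed.

Let LQ' : L / Q%:R <= 8^-1.
Proof. by rewrite ler_pdivrMr//; move: LQ; lra. Qed.

(* The difference quotient of f along coordinate j with step 1/(QN), scaled by 1/Q; Q is so
   large that increments over steps up to 1/Q are read off their residues modulo 1. *)
Definition dquot N x : R := N%:R * incr (Q%:R * N%:R)^-1 x.

Let step_small N : (0 < N)%N -> L * (N%:R * `|(Q%:R * N%:R)^-1|) <= 8^-1.
Proof.
move=> N0; have NR : 0 < N%:R :> R by rewrite ltr0n.
rewrite ger0_norm ?invr_ge0 ?mulr_ge0 ?ler0n//.
by rewrite invfM [N%:R * _]mulrC divfK ?gt_eqF.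
Qed.

Lemma quot_le N x : (0 < N)%N -> `|dquot N x| <= 8^-1.
Proof.
move=> N0; apply: le_trans (step_small N0); rewrite normrM normr_nat mulrCA.
by rewrite ler_wpM2l// incr_le.
Qed.

Lemma lip_quot N : (0 < N)%N -> lip j.+1 (dquot N).
Proof.
move=> N0; apply: lipZ; exists (L + L) => [|x y]; first exact: addr_ge0.
apply: incr_lip; apply: le_trans (step_small N0).
by rewrite ler_wpM2l// ler_peMl// ler1n.
Qed.

(** Averaging translates contracts the L^2 norm and preserves the mean, so this identity makes norms
    increase under refinement and gives all quotients the same mean. *)
Lemma quot_refine N K x : (0 < N)%N -> (0 < K)%N ->
  dquot N x = K%:R^-1 * \sum_(r < K) dquot (N * K) (shiftc j (r%:R * (Q%:R * (N * K)%:R)^-1) x).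
Proof.
move=> N0 K0; have NR : 0 < N%:R :> R by rewrite ltr0n.
have KR : 0 < K%:R :> R by rewrite ltr0n.
have NK0 : (0 < N * K)%N by rewrite muln_gt0 N0.
set s := (Q%:R * (N * K)%:R)^-1.
have e : (Q%:R * N%:R)^-1 = K%:R * s.
  by rewrite /s natrM; field; rewrite !gt_eqF.
rewrite /dquot e incr_add; last first.
  apply: le_trans (step_small NK0); rewrite -/s ler_wpM2l// ler_wpM2r// ler_nat.
  by rewrite leq_pmull.
rewrite -/s -mulr_sumr natrM mulrA; congr (_ * _).
by field; rewrite gt_eqF.
Qed.

Lemma hmean_quot N : (0 < N)%N -> hmean j.+1 (dquot N) = hmean j.+1 (dquot 1).
Proof.
move=> N0; have NR : 0 < N%:R :> R by rewrite ltr0n.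
have -> : dquot 1 = fun x => N%:R^-1 * \sum_(r < N) dquot N (shiftc j (r%:R * (Q%:R * N%:R)^-1) x).
  by apply/funext => x; rewrite (quot_refine x _ N0)// mul1n.
have h (r : nat) : lip j.+1 (fun x => dquot N (shiftc j (r%:R * (Q%:R * N%:R)^-1) x)).
  by apply: lip_sh; exact: lip_quot.
have hs := lip_sum (F := fun (r : nat) x => dquot N (shiftc j (r%:R * (Q%:R * N%:R)^-1) x))
  (fun i (_ : (i < N)%N) => h i).
rewrite (hmeanZ _ hs).
rewrite (hmean_sum (F := fun (r : nat) x => dquot N (shiftc j (r%:R * (Q%:R * N%:R)^-1) x)))//.
under eq_bigr do rewrite (hmean_sh _ (lip_quot N0)).
by rewrite sumr_const card_ord -[hmean _ _ *+ _]mulr_natl mulKf// gt_eqF.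
Qed.

(** The degree of the loop that f describes when coordinate j runs once around the circle through
    x. *)
Definition winding x : R := \sum_(r < Q) dquot 1 (shiftc j (r%:R / Q%:R) x).

Lemma winding_int x : winding x \is a Num.int.
Proof.
pose h r := f (shiftc j (r%:R / Q%:R) x).
have e r : h r.+1 - h r - dquot 1 (shiftc j (r%:R / Q%:R) x) \is a Num.int.
  rewrite /dquot mul1r mulr1 /h; have := incr_int Q%:R^-1 (shiftc j (r%:R / Q%:R) x).
  by rewrite shiftcD -natr1 mulrDl mul1r.
have hQ : h Q - h 0%N \is a Num.int.
  apply: distZ_eq0; apply/eqP; rewrite eq_le distZ_ge0 andbT; apply: le_trans (hf _ _) _.
  by rewrite pdist_sh_id mul0r subr0 divff ?gt_eqF// distZ_int// mulr0.
have : \sum_(r < Q) (h r.+1 - h r - dquot 1 (shiftc j (r%:R / Q%:R) x)) \is a Num.int.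
  by apply: rpred_sum => r _; exact: e.
rewrite sumrB -(big_mkord xpredT (fun r => h r.+1 - h r)) telescope_sumr//.
by move=> /(rpredB hQ); rewrite opprB addrC subrK.
Qed.

Lemma lip_winding : lip j.+1 winding.
Proof.
apply: (lip_sum (F := fun (r : nat) x => dquot 1 (shiftc j (r%:R / Q%:R) x))) => r _.
by apply: lip_sh; exact: lip_quot.
Qed.

Lemma winding_cst x y : winding x = winding y.
Proof.
have [M M0 hM] := lip_winding.
(* The segment from x to y is cut into n pieces so short that the Lipschitz function [winding]
   changes by less than 1 on each; being integer-valued, it does not change. *)
pose z t : pt := fun i => x i + t * (y i - x i).
pose B := \sum_(i < j.+1) `|y i - x i|.
have B0 : 0 <= B by apply: sumr_ge0.
have hz s t : pdist j.+1 (z s) (z t) <= `|s - t| * B.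
  rewrite mulr_sumr; apply: ler_sum => i _; apply: le_trans (distZ_le_norm _) _.
  rewrite -normrM /z (_ : x i + _ - _ = (s - t) * (y i - x i))//; ring.
pose n := (Num.truncn (M * B)).+1.
have nR : 0 < n%:R :> R by rewrite ltr0n.
have MB : M * B < n%:R by rewrite /n truncnS_gt.
have step (i : nat) : winding (z (i.+1%:R / n%:R)) = winding (z (i%:R / n%:R)).
  apply/subr0_eq/int_lt1; first by rewrite rpredB// winding_int.
  apply: le_lt_trans (hM _ _) _.
  apply: le_lt_trans (_ : M * (n%:R^-1 * B) < 1).
    rewrite ler_wpM2l//; apply: le_trans (hz _ _) _.
    by rewrite -mulrBl -natr1 addrAC subrr add0r mul1r ger0_norm// invr_ge0.
  by rewrite mulrCA ltr_pdivrMl// mulr1.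
have h (i : nat) : winding (z (i%:R / n%:R)) = winding (z 0).
  by elim: i => [|i IH]; [rewrite mul0r|rewrite step].
have := h n; rewrite divff ?gt_eqF// => e.
have <- : z 0 = x by apply/funext => i; rewrite /z mul0r addr0.
by rewrite -e; congr winding; apply/funext => i; rewrite /z mul1r addrC subrK.
Qed.

Lemma hmean_quot1 x : hmean j.+1 (dquot 1) = winding x / Q%:R.
Proof.
apply: (mulIf (lt0r_neq0 QR)); rewrite divfK ?gt_eqF//.
rewrite -(hmean_cst j.+1 (winding x)).
have -> : (fun=> winding x) = winding by apply/funext => y; exact: winding_cst.
rewrite (hmean_sum (F := fun (r : nat) x => dquot 1 (shiftc j (r%:R / Q%:R) x))); last first.
  by move=> r _; apply: lip_sh; exact: lip_quot.
under eq_bigr do rewrite (hmean_sh _ (lip_quot (ltn0Sn 0))).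
by rewrite sumr_const card_ord -[hmean _ _ *+ _]mulr_natr.
Qed.

(* By the intermediate value theorem H cannot leave the 1/4-neighbourhood of [H t], as its
   distance to [H t] modulo 1 stays below 1/8. *)
Lemma lift_increment (H : R -> R) x t : continuous H ->
  (forall u, H u - f (upd x j u) \is a Num.int) ->
  H (t + Q%:R^-1) - H t = dquot 1 (upd x j t).
Proof.
move=> cH hH; rewrite /dquot mul1r mulr1.
have Qi : 0 < Q%:R^-1 :> R by rewrite invr_gt0.
have near u : t <= u <= t + Q%:R^-1 -> distZ (H u - H t) <= 8^-1.
  move=> hu.
  have -> : distZ (H u - H t) = distZ (f (shiftc j (u - t) (upd x j t)) - f (upd x j t)).
    apply: distZ_eqint; rewrite shiftc_upd addrCA subrr addr0.
    by apply: (eq_int (rpredB (hH u) (hH t))); ring.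
  apply: le_trans (incr_le _ _) _; apply: le_trans LQ'; rewrite ler_wpM2l//.
  by rewrite ger0_norm; lra.
have no4 c : t <= c <= t + Q%:R^-1 -> `|H c - H t| <> 4^-1.
  move=> hc h4; have := near c hc; rewrite distZ_small h4; lra.
have small : `|H (t + Q%:R^-1) - H t| < 4^-1.
  rewrite ltNge; apply/negP => big.
  have tQ : t <= t + Q%:R^-1 by lra.
  have cw : {within `[t, t + Q%:R^-1], continuous H} by exact: continuous_subspaceT.
  move: big; rewrite ler_normr => /orP[big|big].
    have [|c] := @IVT R H _ _ (H t + 4^-1) tQ cw.
      by rewrite ge_min le_max; apply/andP; split; apply/orP; [left|right]; move: big; lra.
    rewrite in_itv /= => hc Hc; apply: (no4 c hc).
    by rewrite Hc addrAC subrr add0r ger0_norm.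
  have [|c] := @IVT R H _ _ (H t - 4^-1) tQ cw.
    by rewrite ge_min le_max; apply/andP; split; apply/orP; [right|left]; move: big; lra.
  rewrite in_itv /= => hc Hc; apply: (no4 c hc).
  by rewrite Hc addrAC subrr add0r normrN ger0_norm.
apply: int_eq.
  apply: (eq_int (rpredD (rpredB (hH (t + Q%:R^-1)) (hH t)) (incr_int Q%:R^-1 (upd x j t)))).
  by rewrite shiftc_upd; ring.
have : `|incr Q%:R^-1 (upd x j t)| <= 8^-1.
  apply: le_trans (incr_le _ _) _.
  by rewrite ger0_norm ?invr_ge0 ?ler0n.
move: small; lra.
Qed.

Lemma winding_degree (H : R -> R) x : continuous H ->
  (forall u, H u - f (upd x j u) \is a Num.int) ->
  winding (upd x j 0) = H 1 - H 0.
Proof.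
move=> cH hH; rewrite /winding.
rewrite (eq_bigr (fun r : 'I_Q => H (r.+1%:R / Q%:R) - H (r%:R / Q%:R))); last first.
  move=> r _; rewrite shiftc_upd add0r -(lift_increment _ cH hH).
  by rewrite -natr1 mulrDl mul1r.
rewrite -(big_mkord xpredT (fun r => H (r.+1%:R / Q%:R) - H (r%:R / Q%:R))).
by rewrite (telescope_sumr (fun r => H (r%:R / Q%:R)))// divff ?gt_eqF// mul0r.
Qed.

End fibre_increments.

(** * Averages of translates along one coordinate, and their adjoints *)

Section fibre_averages.
Variable R : realType.
Local Notation pt := (nat -> R).
Implicit Types (x y : pt) (F G u v : pt -> R) (j K r n : nat) (s : R).

Definition sh_avg j K (c : nat -> R) F x : R := K%:R^-1 * \sum_(r < K) F (shiftc j (c r) x).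

Lemma lip_sh_avg k j K (c : nat -> R) F : lip k F -> lip k (sh_avg j K c F).
Proof.
move=> h; apply/lipZ/(lip_sum (F := fun r x => F (shiftc j (c r) x))) => r _.
exact: lip_sh.
Qed.

Lemma hmean_sh_avg_sqr_le j K (c : nat -> R) F : lip j.+1 F ->
  hmean j.+1 (fun x => sh_avg j K c F x ^+ 2) <= hmean j.+1 (fun x => F x ^+ 2).
Proof.
move=> h; have F2 := lip_sqr h.
case: K => [|K].
  rewrite [X in hmean _ X](_ : _ = fun=> 0); last first.
    by apply/funext => x; rewrite /sh_avg big_ord0 mulr0 expr0n.
  by rewrite hmean_cst; apply: hmean_ge0 => // x; exact: sqr_ge0.
have hi r : lip j.+1 (fun x => F (shiftc j (c r) x) ^+ 2) by exact: (lip_sh j (c r) F2).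
have hs : lip j.+1 (fun x => \sum_(r < K.+1) F (shiftc j (c r) x) ^+ 2).
  exact: (lip_sum (F := fun r x => F (shiftc j (c r) x) ^+ 2)).
apply: le_trans (_ : hmean j.+1 (fun x => K.+1%:R^-1 * \sum_(r < K.+1) F (shiftc j (c r) x) ^+ 2) <= _).
  apply: hmean_le => [||x]; first exact/lip_sqr/lip_sh_avg.
    exact: lipZ.
  exact: (sqr_mean_le K.+1 (fun r => F (shiftc j (c r) x))).
rewrite hmeanZ// (hmean_sum (F := fun r x => F (shiftc j (c r) x) ^+ 2))//.
under eq_bigr do rewrite (hmean_sh _ F2).
by rewrite sumr_const card_ord -[hmean _ _ *+ _]mulr_natl mulKf// pnatr_eq0.
Qed.

(* With b the averaging operator u = b v and b^* its adjoint, this reads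
   |v - b^* b v|^2 <= |v|^2 - |b v|^2, since <v, b^* b v> = |b v|^2 and b^* is a contraction. *)
Lemma hmean_sub_adjoint_le j K (c : nat -> R) v :
  (0 < K)%N -> lip j.+1 v ->
  hmean j.+1 (fun x => (v x - sh_avg j K (fun r => - c r) (sh_avg j K c v) x) ^+ 2) <=
    hmean j.+1 (fun x => v x ^+ 2) - hmean j.+1 (fun x => sh_avg j K c v x ^+ 2).
Proof.
move=> K0 hv; set u := sh_avg j K c v; set w := sh_avg j K _ u.
have KR : 0 < K%:R :> R by rewrite ltr0n.
have hu : lip j.+1 u by exact: lip_sh_avg.
have hw : lip j.+1 w by exact: lip_sh_avg.
have hvs r : lip j.+1 (fun x => v (shiftc j (c r) x) * u x) by apply: lipM => //; exact: lip_sh.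
have hus r : lip j.+1 (fun x => v x * u (shiftc j (- c r) x)) by apply: lipM => //; exact: lip_sh.
have cross : hmean j.+1 (fun x => v x * w x) = hmean j.+1 (fun x => u x ^+ 2).
  have -> : (fun x => v x * w x) =
      (fun x => K%:R^-1 * \sum_(r < K) v x * u (shiftc j (- c r) x)).
    by apply/funext => x; rewrite /w /sh_avg mulrCA mulr_sumr.
  have -> : (fun x => u x ^+ 2) =
      (fun x => K%:R^-1 * \sum_(r < K) v (shiftc j (c r) x) * u x).
    by apply/funext => x; rewrite expr2 {1}/u /sh_avg -mulrA mulr_suml.
  rewrite !hmeanZ; [|exact: (lip_sum (F := fun r x => v (shiftc j (c r) x) * u x))
    |exact: (lip_sum (F := fun r x => v x * u (shiftc j (- c r) x)))].
  congr (_ * _).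
  rewrite (hmean_sum (F := fun r x => v (shiftc j (c r) x) * u x))//.
  rewrite (hmean_sum (F := fun r x => v x * u (shiftc j (- c r) x)))//.
  apply: eq_bigr => r _; rewrite -(hmean_sh (c r) (hus r)); congr hmean.
  by apply/funext => x; rewrite shiftcD subrr shiftc0.
have v2 := lip_sqr hv; have w2 := lip_sqr hw; have vw := lipM hv hw.
have -> : (fun x => (v x - w x) ^+ 2) = (fun x => v x ^+ 2 - 2 * (v x * w x) + w x ^+ 2).
  by apply/funext => x; ring.
rewrite hmeanD ?hmeanB ?hmeanZ ?cross//; [|exact: lipZ|by apply: lipB => //; exact: lipZ].
have := hmean_sh_avg_sqr_le K (fun r => - c r) hu; rewrite -/w; lra.
Qed.

End fibre_averages.

(** * Decay of correlations of antiperiodic functions, given ergodicity one dimension below *)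

Section mixing.
Variables (R : realType) (d : nat) (alpha : R) (g : nat -> (nat -> R) -> R).
Local Notation pt := (nat -> R).
Implicit Types (x y : pt) (F G psi h : pt -> R) (k i n N K : nat) (s t : R).

Hypothesis gdep : triangular g.
Hypothesis glip : tri_lip d g.

Local Notation T := (skewp alpha g).
Local Notation avg := (birkhoff alpha g).

Lemma iter_skewp_sh j s n x i : (i < j.+1)%N ->
  iter n T (shiftc j s x) i = shiftc j s (iter n T x) i.
Proof.
move=> ij; elim: n i ij => [//|n IH] i ij; rewrite !iterS.
rewrite (skewp_eq alpha gdep (k := j.+1) (y := shiftc j s (iter n T x)))// {1}/shiftc skewp_upd//.
by rewrite /shiftc addrAC addrCA subrr addr0.
Qed.

Lemma lip_iter_sh j s n x F : lip j.+1 F -> F (iter n T (shiftc j s x)) = F (shiftc j s (iter n T x)).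
Proof. by move=> h; apply: (lip_eq h) => i; exact: iter_skewp_sh. Qed.

Lemma avg_sh_avg j n K (c : nat -> R) F x : lip j.+1 F ->
  avg n (sh_avg j K c F) x = sh_avg j K c (avg n F) x.
Proof.
move=> hF; rewrite /sh_avg {1}/birkhoff -mulr_sumr mulrCA; congr (_ * _).
rewrite exchange_big /= mulr_sumr; apply: eq_bigr => r _.
by congr (_ * _); apply: eq_bigr => i _; rewrite (lip_iter_sh _ _ _ hF).
Qed.

Variables (j : nat) (L : R) (Q : nat).
Hypothesis jd : (j.+1 < d)%N.
Hypothesis L0 : 0 <= L.
Hypothesis hL : forall x y, distZ (g j x - g j y) <= L * pdist j.+1 x y.
Hypothesis Q0 : (0 < Q)%N.
Hypothesis LQ : 8 * L <= Q%:R.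
Hypothesis ergj : forall F, lip j.+1 F -> hmean j.+1 F = 0 -> erg alpha g j.+1 F.

Local Notation quot := (dquot (g j) j Q).
Let D := hmean j.+1 (quot 1).

Let jd' : (j.+1 <= d)%N. Proof. exact: ltnW. Qed.

Let lip_q N : (0 < N)%N -> lip j.+1 (quot N).
Proof. exact: (lip_quot L0 hL Q0 LQ). Qed.

(* N is chosen so that the squared L^2 norm of [quot N] is close to the supremum over all N:
   this makes the estimate uniform in the refinement K. *)
Lemma quot_equidistributed (e : R) : 0 < e -> exists2 N, (0 < N)%N &
  exists n0, forall K n, (0 < K)%N -> (n0 <= n)%N ->
    hmean j.+1 (fun x => avg n (fun y => quot (N * K) y - D) x ^+ 2) <= e.
Proof.
move=> e0; have e4 : 0 < e / 4 by rewrite divr_gt0.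
pose m N := hmean j.+1 (fun x => quot N x ^+ 2).
pose S := [set z : R | exists2 N, (0 < N)%N & z = m N].
have m1 N : (0 < N)%N -> m N <= 1.
  move=> N0; apply: hmean_le_cst => [|x]; first exact/lip_sqr/lip_q.
  have q8 := quot_le L0 hL Q0 LQ x N0.
  by rewrite -real_normK ?num_real// expr_le1//; apply: le_trans q8 _; lra.
have hS : has_sup S.
  split; first by exists (m 1%N); exists 1%N.
  by exists 1 => _ [N N0 ->]; exact: m1.
have [_ [N N0 ->] hN] := sup_adherent e4 hS.
have hD : lip j.+1 (fun x => quot N x - D) by apply: lipB; [exact: lip_q|exact: lip_cst].
have D0 : hmean j.+1 (fun x => quot N x - D) = 0.
  rewrite hmeanB ?hmean_cst; [|exact: lip_q|exact: lip_cst].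
  by rewrite /D (hmean_quot L0 hL Q0 LQ N0) subrr.
have [n0 hn0] := ergj hD D0 e4.
exists N => //; exists n0 => K n K0 nn0.
have NK0 : (0 < N * K)%N by rewrite muln_gt0 N0.
pose c (r : nat) := r%:R * (Q%:R * (N * K)%:R)^-1 : R.
(* As an average of translates of [quot N], w has Birkhoff averages controlled by those of [quot N]
   alone, with [n0] fixed before K. And w is close to v, because the squared norm of v exceeds that
   of [quot N] by at most e / 4. *)
pose v := quot (N * K); pose w := sh_avg j K (fun r => - c r) (quot N).
have hv : lip j.+1 v by exact: lip_q.
have hw : lip j.+1 w by apply: lip_sh_avg; exact: lip_q.
have uE : sh_avg j K c v = quot N.
  by apply/funext => x; rewrite (quot_refine L0 hL Q0 LQ x N0 K0).
have vw : hmean j.+1 (fun x => (v x - w x) ^+ 2) <= e / 4.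
  have := hmean_sub_adjoint_le c K0 hv; rewrite /= uE -/w.
  have : m (N * K)%N <= sup S by apply: ub_le_sup; [exact: hS.2|exists (N * K)%N].
  move: hN; rewrite /m -/v; lra.
have KR : K%:R != 0 :> R by rewrite pnatr_eq0 -lt0n.
have wD : (fun x => w x - D) = sh_avg j K (fun r => - c r) (fun x => quot N x - D).
  apply/funext => x; rewrite /w /sh_avg sumrB mulrBr sumr_const card_ord.
  by rewrite -[D *+ K]mulr_natl mulKf.
have -> : (fun x => avg n (fun y => v y - D) x ^+ 2) =
    (fun x => (avg n (fun y => v y - w y) x + avg n (fun y => w y - D) x) ^+ 2).
  apply/funext => x; rewrite -avgD; congr (_ ^+ 2); congr (_ * _).
  by apply: eq_bigr => i _; rewrite addrA subrK.
have hvw : lip j.+1 (fun x => v x - w x) by exact: lipB.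
have hwD : lip j.+1 (fun x => w x - D) by apply: lipB => //; exact: lip_cst.
apply: le_trans (hmean_sqrD_le _ _) _; [exact: (lip_avg alpha glip)..|].
have b1 := hmean_avg_sqr_le alpha gdep glip n jd' hvw.
have b2 : hmean j.+1 (fun x => avg n (fun y => w y - D) x ^+ 2) <= e / 4.
  rewrite wD; apply: le_trans (hn0 n nn0).
  under eq_fun do rewrite (avg_sh_avg _ _ _ _ hD).
  by apply: hmean_sh_avg_sqr_le; exact: (lip_avg alpha glip).
move: vw b1 b2; lra.
Qed.

Lemma iter_skewp_next s n x :
  iter n T (shiftc j s x) j.+1 - (iter n T x j.+1 + \sum_(i < n) incr (g j) j s (iter i T x))
    \is a Num.int.
Proof.
elim: n => [|n IH].
  by rewrite big_ord0 addr0 /= /shiftc upd_neq ?subrr// neq_ltn ltnSn orbT.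
rewrite big_ord_recr !iterS /=.
have -> : g j (iter n T (shiftc j s x)) = g j (shiftc j s (iter n T x)).
  by apply: gdep => l lj; exact: iter_skewp_sh.
apply: (eq_int (rpredD IH (incr_int (g j) j s (iter n T x)))); ring.
Qed.

Lemma near_antiperiod Lp psi tau s n x : 0 <= Lp -> lipc Lp j.+2 psi -> antiperiodic j.+1 tau psi ->
  `|psi (iter n T (shiftc j s x)) + psi (iter n T x)| <=
    Lp * (`|s| + `|\sum_(i < n) incr (g j) j s (iter i T x) - tau|).
Proof.
move=> Lp0 hp anti; rewrite -[X in _ + X]opprK -anti; apply: le_trans (hp _ _) _.
rewrite ler_wpM2l// pdistS; apply: lerD.
  apply: le_trans (distZ_le_norm s).
  rewrite [pdist _ _ _](@eq_pdist _ _ _ (shiftc j s (iter n T x)) _ (iter n T x)); last 2 first.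
  - by move=> i ij; exact: iter_skewp_sh.
  - by move=> i ij; rewrite /shiftc upd_neq// neq_ltn ij.
  by rewrite -{2}(shiftc0 (iter n T x) j) pdist_sh_id subr0.
apply: le_trans (distZ_le_norm _); rewrite /shiftc upd_eq le_eqVlt; apply/orP; left; apply/eqP.
apply: distZ_eqint; apply: (eq_int (iter_skewp_next s n x)); rewrite /shiftc; ring.
Qed.

Hypothesis D0 : D != 0.

(** With Phi = h (psi o T^n), shift invariance equates twice the mean of Phi with the mean of Phi
    plus its translate by s in coordinate j. Pointwise that sum is small up to the Birkhoff
    deviation [err], which ignores coordinate j + 1; hence [n0] serves all t. *)
Lemma fibre_mixing psi h sg (e : R) : lip j.+2 psi -> lip j.+2 h -> antiperiodic j.+1 sg psi -> 0 < e ->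
  exists n0, forall n, (n0 <= n)%N -> forall t,
    `|hmean j.+1 (fun x => h (upd x j.+1 t) * psi (iter n T (upd x j.+1 t)))| <= e.
Proof.
move=> hpsi hh anti e0.
have [sg0|sgN0] := eqVneq sg 0.
  exists 0%N => n _ t; rewrite [X in hmean _ X](_ : _ = fun=> 0) ?hmean_cst ?normr0 ?ltW//.
  apply/funext => x; have := anti (iter n T (upd x j.+1 t)); rewrite sg0 shiftc0.
  set a := psi _ => ha; have -> : a = 0 by lra.
  by rewrite mulr0.
have [Cp Cp0 bp] := lip_bound hpsi; have [Ch Ch0 bh] := lip_bound hh.
have [Lp Lp0 hp] := hpsi; have [Lh Lh0 hhL] := hh.
(* The n increments will add up to [rho * (D + err)] with rho = n / (N K). Making rho close to c
   brings the sum close to c D, which is sg or -sg and so an antiperiod. *)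
pose c := `|sg| / `|D|.
have c0 : 0 < c by rewrite divr_gt0 ?normr_gt0.
have [tau anti' tauE] : exists2 tau, antiperiodic j.+1 tau psi & tau = c * D.
  have [Dp|Dn] := ltP 0 D.
    exists `|sg|; last by rewrite /c (gtr0_norm Dp) divfK.
    by have [p|p] := leP 0 sg; [rewrite ger0_norm|rewrite ltr0_norm//; exact: antiperiodicN].
  exists (- `|sg|); last by rewrite /c (ler0_norm Dn) invrN mulrN mulNr divfK.
  by have [p|p] := leP 0 sg; [rewrite ger0_norm//; exact: antiperiodicN|rewrite ltr0_norm// opprK].
(* [A1] collects the errors of order 1 / K: the displacement s, the rounding of rho, and the
   variation of h. [A2] is the factor of [err]. *)
pose A1 := Ch * Lp * (1 + c) + Lh * Cp; pose A2 := 2 * c * (Ch * Lp).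
have A10 : 0 <= A1 by rewrite addr_ge0 ?mulr_ge0// addr_ge0// ltW.
have A20 : 0 <= A2 by rewrite !mulr_ge0// ltW.
pose e1 := e / (2 * (A2 + 1)).
have e10 : 0 < e1 by rewrite divr_gt0// mulr_gt0// ltr_pwDr.
have [N N0 [n1 hn1]] := quot_equidistributed (mulr_gt0 e10 e10).
have NR : 0 < N%:R :> R by rewrite ltr0n.
pose K1 := (Num.truncn (A1 / e)).+1.
exists (maxn n1 (Num.truncn (K1%:R * (N%:R * c))).+1) => n.
rewrite geq_max => /andP[nn1 nn2] t.
have Nc0 : 0 < N%:R * c by rewrite mulr_gt0.
(* Rounding down gives rho between c and c + c / K; K is large as soon as n is, whatever t. *)
pose K := Num.truncn (n%:R / (N%:R * c)).
have /andP[K2 K3] : K%:R <= n%:R / (N%:R * c) < K.+1%:R.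
  by rewrite truncn_itv// divr_ge0// ltW.
have K1K : (K1 <= K)%N.
  rewrite truncn_ge_nat ?divr_ge0 ?(ltW Nc0)//.
  rewrite ler_pdivlMr//; apply: le_trans (_ : (Num.truncn (K1%:R * (N%:R * c))).+1%:R <= _).
    by rewrite ltW// truncnS_gt.
  by rewrite ler_nat.
have K0 : (0 < K)%N by apply: leq_trans K1K.
have KR : 0 < K%:R :> R by rewrite ltr0n.
have QR : 0 < Q%:R :> R by rewrite ltr0n.
have nR : 0 < n%:R :> R.
  by rewrite ltr0n; apply: leq_trans nn2.
have A1K : A1 / K%:R <= e.
  rewrite ler_pdivrMr// mulrC -ler_pdivrMr//.
  apply: le_trans (_ : K1%:R <= _); last by rewrite ler_nat.
  by rewrite ltW// /K1 truncnS_gt.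
have NK0 : (0 < N * K)%N by rewrite muln_gt0 N0.
have NKR : 0 < (N * K)%:R :> R by rewrite ltr0n.
pose s := (Q%:R * (N * K)%:R)^-1 : R.
have s0 : 0 < s by rewrite invr_gt0 mulr_gt0.
have sK : s <= K%:R^-1.
  rewrite lef_pV2 ?posrE ?mulr_gt0// natrM mulrA ler_peMl ?ler0n//.
  by rewrite -natrM ler1n muln_gt0 Q0.
pose rho := n%:R / (N * K)%:R : R.
have rhoE : rho * K%:R = n%:R / N%:R by rewrite /rho natrM; field; rewrite !gt_eqF.
have rho1 : c <= rho.
  rewrite -(ler_pM2r KR) rhoE ler_pdivlMr//.
  by move: K2; rewrite ler_pdivlMr// mulrCA; lra.
have rho2 : rho - c <= c / K%:R.
  rewrite ler_pdivlMr// mulrBl rhoE -[X in _ <= X]addr0 -lerBlDl.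
  move: K3; rewrite ltr_pdivrMr// -natr1 => K3.
  have : n%:R / N%:R <= (K%:R + 1) * c by rewrite ler_pdivrMr//; lra.
  lra.
have K1R : 1 <= K%:R :> R by rewrite ler1n.
have cK : c / K%:R <= c by rewrite ler_pdivrMr// ler_peMr// ltW.
have D1 : `|D| <= 1.
  apply: hmean_norm_le_cst => [|x]; first exact: lip_q.
  by apply: le_trans (quot_le L0 hL Q0 LQ x (ltn0Sn 0)) _; lra.
pose err x := avg n (fun y => quot (N * K) y - D) x.
have herr : lip j.+1 err.
  by apply: (lip_avg alpha glip) => //; apply: lipB; [exact: lip_q|exact: lip_cst].
have sumE y : \sum_(i < n) incr (g j) j s (iter i T y) = rho * (D + err y).
  have -> : err y = n%:R^-1 * \sum_(i < n) quot (N * K) (iter i T y) - D.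
    rewrite /err /birkhoff sumrB mulrBr sumr_const card_ord.
    by rewrite -[D *+ n]mulr_natl mulKf ?gt_eqF.
  rewrite addrC subrK /rho /dquot -mulr_sumr -/s; field.
  by rewrite !gt_eqF.
have near y : `|\sum_(i < n) incr (g j) j s (iter i T y) - tau| <= c / K%:R + 2 * c * `|err y|.
  rewrite sumE tauE (_ : _ - _ = (rho - c) * D + rho * err y); last by ring.
  apply: le_trans (ler_normD _ _) _; rewrite (normrM (rho - c)) (normrM rho); apply: lerD.
    rewrite -[X in _ <= X]mulr1; apply: ler_pM => //.
    by rewrite ger0_norm// subr_ge0.
  rewrite ler_wpM2r// ger0_norm; last by move: c0 rho1; lra.
  by move: rho2 cK; lra.
pose Phi y := h y * psi (iter n T y).
have pw y : `|Phi y + Phi (shiftc j s y)| <= A1 / K%:R + A2 * `|err y|.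
  have -> : Phi y + Phi (shiftc j s y) = h y * (psi (iter n T (shiftc j s y)) + psi (iter n T y))
      + (h (shiftc j s y) - h y) * psi (iter n T (shiftc j s y)) by rewrite /Phi; ring.
  apply: le_trans (ler_normD _ _) _; rewrite (normrM (h y)) (normrM (h _ - _)).
  have t1 : `|h y| * `|psi (iter n T (shiftc j s y)) + psi (iter n T y)| <=
      Ch * (Lp * (K%:R^-1 + (c / K%:R + 2 * c * `|err y|))).
    apply: ler_pM => //; apply: le_trans (near_antiperiod _ _ _ Lp0 hp anti') _.
    rewrite ler_wpM2l//; apply: lerD; last exact: near.
    by rewrite ger0_norm// ltW.
  have t2 : `|h (shiftc j s y) - h y| * `|psi (iter n T (shiftc j s y))| <= Lh * K%:R^-1 * Cp.
    apply: ler_pM => //; apply: le_trans (hhL _ _) _; rewrite ler_wpM2l//.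
    apply: le_trans sK; rewrite pdistS -[X in pdist _ _ X](shiftc0 y j) pdist_sh_id subr0.
    rewrite /shiftc upd_neq ?neq_ltn ?ltnSn ?orbT//.
    by rewrite subrr distZ0 addr0; apply: le_trans (distZ_le_norm _) _; rewrite ger0_norm// ltW.
  apply: le_trans (lerD t1 t2) _; rewrite /A1 /A2 le_eqVlt; apply/orP; left; apply/eqP. ring.
have hPhi : lip j.+2 Phi by apply: lipM => //; exact: (lip_iter alpha glip).
pose P x := Phi (upd x j.+1 t).
have hP : lip j.+1 P by exact: lip_upd.
have hPs : lip j.+1 (fun x => P (shiftc j s x)) by exact: lip_sh.
have e2P : 2 * hmean j.+1 P = hmean j.+1 (fun x => P x + P (shiftc j s x)).
  by rewrite hmeanD// hmean_sh//; ring.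
have habs := lip_norm herr.
have hsq : lip j.+1 (fun x => err x ^+ 2 / e1).
  by under eq_fun do rewrite mulrC; apply: lipZ; exact: lip_sqr.
have b1 : `|2 * hmean j.+1 P| <= A1 / K%:R + A2 * hmean j.+1 (fun x => `|err x|).
  rewrite e2P -[A1 / _](hmean_cst j.+1) -hmeanZ// -hmeanD; [|exact: lip_cst|exact: lipZ].
  apply: hmean_norm_le => [||x].
  - exact: lipD.
  - by apply: lipD; [exact: lip_cst|exact: lipZ].
  rewrite /P -shiftc_updC ?neq_ltn ?ltnSn//; apply: le_trans (pw _) _.
  rewrite lerD2l (_ : err (upd x j.+1 t) = err x)//.
  by apply: (lip_eq herr) => i ij; rewrite upd_neq// neq_ltn ij.
(* From L^2 to L^1 by [|err| <= e1 + err ^+ 2 / e1]; this is why the ergodic estimate was requested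
   with precision [e1 * e1]. *)
have b2 : hmean j.+1 (fun x => `|err x|) <= 2 * e1.
  apply: le_trans (_ : hmean j.+1 (fun x => e1 + e1^-1 * err x ^+ 2) <= _).
    apply: hmean_le => // [|x].
      by apply: lipD; [exact: lip_cst|apply: lipZ; exact: lip_sqr].
    have [le|lt] := leP `|err x| e1.
      by apply: le_trans le _; rewrite lerDl mulr_ge0 ?invr_ge0 ?sqr_ge0// ltW.
    apply: le_trans (_ : e1^-1 * err x ^+ 2 <= _); last by rewrite lerDr ltW.
    rewrite ler_pdivlMl// -real_normK ?num_real// expr2; apply: ler_wpM2r => //.
    exact: ltW.
  rewrite hmeanD; [|exact: lip_cst|apply: lipZ; exact: lip_sqr].
  rewrite hmean_cst hmeanZ; last exact: lip_sqr.
  have := hn1 K n K0 nn1; rewrite -/(err _) => hm.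
  have : e1^-1 * hmean j.+1 (fun x => err x ^+ 2) <= e1 by rewrite ler_pdivrMl.
  lra.
have b3 : A2 * (2 * e1) <= e.
  rewrite /e1 (_ : A2 * _ = e * (A2 / (A2 + 1))); last by field; rewrite gt_eqF// ltr_pwDr.
  rewrite -[X in _ <= X]mulr1 ler_wpM2l ?(ltW e0)// ler_pdivrMr ?ltr_pwDr// mul1r lerDl//.
have b4 : A2 * hmean j.+1 (fun x => `|err x|) <= e.
  by apply: le_trans b3; rewrite ler_wpM2l.
have : `|2 * hmean j.+1 P| <= 2 * e by apply: le_trans b1 _; move: A1K b4; lra.
by rewrite normrM ger0_norm// ler_pM2l.
Qed.

End mixing.

(** * Induction on the dimension, and Banach-Saks averages *)

Section nondegenerate_skew_product.
Variables (R : realType) (d : nat) (alpha : R) (g : nat -> (nat -> R) -> R).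
Local Notation pt := (nat -> R).
Implicit Types (x y : pt) (F G psi h : pt -> R) (k i j n : nat) (s t : R).

(** The degree is recorded on the circle through the origin; [winding_cst] carries it to all
    others. *)
Definition tri_deg := forall j, (j.+1 < d)%N -> exists (H : R -> R) (m : int),
  [/\ continuous H, forall u, H u - g j (upd (fun=> 0) j u) \is a Num.int,
      m != 0 & H 1 - H 0 = m%:~R].

Hypothesis gdep : triangular g.
Hypothesis glip : tri_lip d g.
Hypothesis gdeg : tri_deg.
Hypothesis irr : irrational alpha.

Local Notation T := (skewp alpha g).

Lemma fibre_mixing_of_erg j : (j.+1 < d)%N ->
  (forall F, lip j.+1 F -> hmean j.+1 F = 0 -> erg alpha g j.+1 F) ->
  forall psi h sg (e : R), lip j.+2 psi -> lip j.+2 h -> antiperiodic j.+1 sg psi -> 0 < e ->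
  exists n0, forall n, (n0 <= n)%N -> forall t,
    `|hmean j.+1 (fun x => h (upd x j.+1 t) * psi (iter n T (upd x j.+1 t)))| <= e.
Proof.
move=> jd ergj psi h sg e hpsi hh anti e0.
have [L L0 hL] := glip jd.
pose Q := (Num.truncn (8 * L)).+1.
have LQ : 8 * L <= Q%:R by rewrite ltW// /Q truncnS_gt.
have [H [m [cH hH m0 Hm]]] := gdeg jd.
apply: (fibre_mixing gdep glip jd L0 hL (ltn0Sn _) LQ ergj _ hpsi hh anti e0).
rewrite (hmean_quot1 L0 hL (ltn0Sn _) LQ (upd (fun=> 0) j 0)).
rewrite (winding_degree L0 hL (ltn0Sn _) LQ cH hH) Hm mulf_neq0//.
by rewrite intr_eq0.
Qed.

(** The induction starts at the 0-torus, where a function of mean zero vanishes. Antiperiodic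
    functions are handled by the rotation on the circle and by [fibre_mixing_of_erg] above it. *)
Lemma erg_all k : (k < d)%N ->
  forall F, lip k.+1 F -> hmean k.+1 F = 0 -> erg alpha g k.+1 F.
Proof.
elim: k => [|k IH] kd; apply: (erg_step gdep glip kd).
- move=> F hF F0 e e0; exists 0%N => n _ /=; rewrite /birkhoff big1 ?mulr0 ?expr0n ?ltW//.
  by move=> i _; rewrite -F0; exact: (lip_eq hF).
- by move=> psi s hpsi anti; exact: (erg_rotation glip kd irr hpsi anti).
- exact: IH (ltnW kd).
- move=> psi s hpsi anti; apply: (mixing_erg gdep glip) => // e e0.
  have [n0 hn0] := fibre_mixing_of_erg kd (IH (ltnW kd)) hpsi hpsi anti e0.
  exists n0 => n nn0; apply: hmean_fibre_bound (hn0 n nn0).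
  by apply: lipM => //; exact: (lip_iter alpha glip).
Qed.

Lemma skew_mixing j psi h sg (e : R) : (j.+1 < d)%N ->
  lip j.+2 psi -> lip j.+2 h -> antiperiodic j.+1 sg psi -> 0 < e ->
  exists n0, forall n, (n0 <= n)%N -> forall t,
    `|hmean j.+1 (fun x => h (upd x j.+1 t) * psi (iter n T (upd x j.+1 t)))| <= e.
Proof. by move=> jd; apply: fibre_mixing_of_erg => //; exact: erg_all (ltnW jd). Qed.

Definition seq_avg (l : seq nat) psi x : R :=
  (size l)%:R^-1 * \sum_(a <- l) psi (iter a T x).

Lemma lip_sum_seq k (l : seq nat) psi : (k <= d)%N -> lip k psi ->
  lip k (fun x => \sum_(a <- l) psi (iter a T x)).
Proof.
move=> kd h; elim: l => [|a l IH].
  by under eq_fun do rewrite big_nil; exact: lip_cst.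
by under eq_fun do rewrite big_cons; apply: lipD => //; exact: (lip_iter alpha glip).
Qed.

(* Banach-Saks: each new time is chosen so late that it is almost orthogonal to the
   sum of the previous ones. *)
Lemma banach_saks j psi sg (sigma : nat -> nat) : (j.+1 < d)%N ->
  lip j.+2 psi -> antiperiodic j.+1 sg psi -> (forall n, (n <= sigma n)%N) ->
  exists2 C : R, 0 <= C & forall i0 M, exists l : seq nat,
    [/\ size l = M, all (leq i0) l & forall t,
      hmean j.+1 (fun x => (\sum_(a <- map sigma l) psi (iter a T (upd x j.+1 t))) ^+ 2)
        <= M%:R * C].
Proof.
move=> jd hpsi anti hs; have [B B0 bB] := lip_bound hpsi.
(* Each new time adds a diagonal term of at most [B * B] and twice a cross term whose mean is at
   most 1. *)
exists (B * B + 2) => [|i0]; first by rewrite addr_ge0// mulr_ge0.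
elim=> [|M [l [sl al hl]]].
  exists [::]; split => // t; under eq_fun do rewrite big_nil expr0n.
  by rewrite hmean_cst mul0r.
have hS : lip j.+2 (fun x => \sum_(a <- map sigma l) psi (iter a T x)) by exact: lip_sum_seq.
(* The whole previous sum serves as the test function h, and the resulting time is good for every t,
   so the list of times does not depend on t. *)
have [n0 hn0] := skew_mixing jd hpsi hS anti ltr01.
pose n := maxn i0 n0.
have nn0 : (n0 <= sigma n)%N by apply: leq_trans (hs n); exact: leq_maxr.
exists (n :: l); split => [|/=|t]; first by rewrite /= sl.
  by rewrite al leq_maxl.
have hu := lip_upd t hS.
have hp : lip j.+1 (fun x => psi (iter (sigma n) T (upd x j.+1 t))).
  exact: (lip_upd t (lip_iter alpha glip (sigma n) jd hpsi)).
have -> : (fun x => (\sum_(a <- map sigma (n :: l)) psi (iter a T (upd x j.+1 t))) ^+ 2) =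
    (fun x => psi (iter (sigma n) T (upd x j.+1 t)) ^+ 2
      + 2 * ((\sum_(a <- map sigma l) psi (iter a T (upd x j.+1 t)))
             * psi (iter (sigma n) T (upd x j.+1 t)))
      + (\sum_(a <- map sigma l) psi (iter a T (upd x j.+1 t))) ^+ 2).
  by apply/funext => x; rewrite /= big_cons; ring.
have p2 := lip_sqr hp; have u2 := lip_sqr hu; have up := lipM hu hp.
rewrite hmeanD ?hmeanD ?hmeanZ//; [|exact: lipZ|by apply: lipD => //; exact: lipZ].
have b1 : hmean j.+1 (fun x => psi (iter (sigma n) T (upd x j.+1 t)) ^+ 2) <= B * B.
  apply: hmean_le_cst => // x; rewrite -real_normK ?num_real// expr2.
  exact: ler_pM.
have := le_trans (ler_norm _) (hn0 _ nn0 t); have := hl t.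
rewrite -[M.+1%:R]natr1 mulrDl mul1r; move: b1; lra.
Qed.

End nondegenerate_skew_product.

(** * Covers by finitely many boxes, and a Chebyshev inequality for them *)

Section box_covers.
Variable R : realType.
Local Notation pt := (nat -> R).
Implicit Types (x y : pt) (F : pt -> R) (k i n : nat) (A B : set pt) (v w : R)
  (b : pt * pt) (l : seq (pt * pt)).

Definition inbox k b x := [forall i : 'I_k, b.1 i <= x i < b.2 i].

Definition volb k b : R := \prod_(i < k) Num.max 0 (b.2 i - b.1 i).

Definition incube k x := forall i, (i < k)%N -> 0 <= x i < 1.

(** An outer content on the unit cube. It links Haar means of Lipschitz functions to the box covers
    of [lebesgue_null] without a Lebesgue measure on tuples. *)
Definition covered k v A := exists l,
  (forall x, incube k x -> A x -> has (fun b => inbox k b x) l) /\ \sum_(b <- l) volb k b <= v.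

Lemma volb_ge0 k b : 0 <= volb k b.
Proof. by apply: prodr_ge0 => i _; rewrite le_max lexx. Qed.

Lemma coveredU k v w A B : covered k v A -> covered k w B -> covered k (v + w) (A `|` B).
Proof.
move=> [l [hl vl]] [m [hm vm]]; exists (l ++ m); split; last first.
  by rewrite big_cat /=; exact: lerD.
by move=> x cx [Ax|Bx]; rewrite has_cat; [rewrite (hl x cx Ax)|rewrite (hm x cx Bx) orbT].
Qed.

Lemma covered_bigcup k n (v : nat -> R) (A : nat -> set pt) :
  (forall r, (r < n)%N -> covered k (v r) (A r)) ->
  covered k (\sum_(r < n) v r) [set x | exists2 r, (r < n)%N & A r x].
Proof.
elim: n => [|n IH] h.
  by exists [::]; split => [x _ [r]//|]; rewrite big_nil big_ord0.
have [l [hl vl]] := coveredU (IH (fun r rn => h r (ltnW rn))) (h n (ltnSn n)).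
exists l; split; last by rewrite big_ord_recr.
move=> x cx [r]; rewrite ltnS leq_eqVlt => /orP[/eqP ->|rn] Ax; apply: hl => //.
  by right.
by left; exists r.
Qed.

Lemma covered_slab k v A (p q : R) : p <= q -> covered k v A ->
  covered k.+1 (v * (q - p)) [set x | A x /\ p <= x k < q].
Proof.
move=> pq [l [hl vl]]; pose ext b : pt * pt := (upd b.1 k p, upd b.2 k q).
exists (map ext l); split.
  move=> x cx [Ax xk]; rewrite has_map.
  apply: sub_has (hl x _ Ax) => [b /forallP/= bx|i ik]; last exact: cx (ltnW _).
  apply/forallP => /= i; have := ltn_ord i; rewrite ltnS leq_eqVlt /upd.
  by case: eqP => [-> //|_ /= ik]; exact: (bx (Ordinal ik)).
rewrite big_map (eq_bigr (fun b => volb k b * (q - p))).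
  by rewrite -mulr_suml ler_wpM2r// subr_ge0.
move=> b _; rewrite /volb big_ord_recr /= !upd_eq; congr (_ * _).
  by apply: eq_bigr => i _; rewrite !upd_neq// neq_ltn ltn_ord.
by apply/max_idPr; rewrite subr_ge0.
Qed.

Lemma coveredS k v A B : (forall x, incube k x -> A x -> B x) ->
  covered k v B -> covered k v A.
Proof. by move=> AB [l [hl vl]]; exists l; split => // x cx /(AB x cx); exact: hl. Qed.

Lemma covered_le k v w A : v <= w -> covered k v A -> covered k w A.
Proof. by move=> vw [l [hl vl]]; exists l; split => //; exact: le_trans vw. Qed.

Lemma grid_cell (G : nat) (t : R) : (0 < G)%N -> 0 <= t < 1 ->
  exists2 r, (r < G)%N & r%:R / G%:R <= t < r.+1%:R / G%:R.
Proof.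
move=> G0 /andP[t0 t1]; have GR : 0 < G%:R :> R by rewrite ltr0n.
have Gt : 0 <= t * G%:R by rewrite mulr_ge0// ltW.
exists (Num.truncn (t * G%:R)); first by rewrite truncn_lt_nat// gtr_pMl.
by rewrite ler_pdivrMr// ltr_pdivlMr// truncn_itv.
Qed.

(** Induction on the dimension: cut coordinate k into Q slabs, on each of which F is within L / Q of
    its value on the left face, and extend covers of the faces for the lowered threshold [dl']. *)
Lemma chebyshev_cover k F (dl v : R) : lip k F -> (forall x, 0 <= F x) -> 0 < dl ->
  hmean k F < dl * v -> covered k v [set x | dl <= F x].
Proof.
elim: k F dl v => [|k IH] F dl v hF F0 dl0 hv.
  have v0 : 0 < v by have := le_lt_trans (F0 _) hv; rewrite pmulr_rgt0.
  (* In dimension 0 a box has volume 1, the empty product; this is within budget because dl <= F <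
     dl v gives 1 < v. *)
  have [le|lt] := leP dl (F (fun=> 0)).
    exists [:: (fun=> 0, fun=> 0)]; split => [x _ _|].
      by rewrite /= orbF; apply/forallP => -[].
    rewrite big_seq1 /volb big_ord0 -(ler_pM2l dl0) mulr1.
    by apply: le_trans le _; exact: ltW.
  exists [::]; split; last by rewrite big_nil ltW.
  by move=> x _ /= le; move: lt; rewrite ltNge (lip_eq hF (y := x))// le.
have v0 : 0 < v by have := le_lt_trans (hmean_ge0 hF F0) hv; rewrite pmulr_rgt0.
have [L L0 hL] := hF; pose s := dl * v - hmean k.+1 F.
have s0 : 0 < s by rewrite subr_gt0.
(* The term L / dl keeps [dl'] positive. The other one gives (1 + v) L / Q <= s / 2, which pays for
   the Riemann sum error and the lowered threshold; the other half of the slack s makes the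
   inequalities on the faces strict. *)
pose Q := (Num.truncn (2 * L * (1 + v) / s + L / dl)).+1.
have QR : 0 < Q%:R :> R by rewrite ltr0n.
have hQ : 2 * L * (1 + v) / s + L / dl < Q%:R by rewrite /Q truncnS_gt.
have q1 : 0 <= 2 * L * (1 + v) / s.
  by rewrite divr_ge0 ?(ltW s0)// !mulr_ge0// addr_ge0// ltW.
have q2 : 0 <= L / dl by rewrite divr_ge0// ltW.
have LQ1 : L / Q%:R < dl.
  rewrite ltr_pdivrMr// mulrC -ltr_pdivrMr//; move: hQ q1; lra.
have LQ2 : L / Q%:R * (1 + v) <= s / 2.
  rewrite mulrAC ler_pdivrMr//.
  have : 2 * L * (1 + v) / s <= Q%:R by move: hQ q2; lra.
  rewrite ler_pdivrMr//; lra.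
pose dl' := dl - L / Q%:R; have dl'0 : 0 < dl' by rewrite subr_gt0.
pose Fr (r : nat) x := F (upd x k (r%:R / Q%:R)).
have hFr r : lip k (Fr r) by exact: lip_upd.
pose vr r := (hmean k (Fr r) + s / 2) / dl'.
have hc r : covered k (vr r) [set x | dl' <= Fr r x].
  apply: IH => // [x|]; first exact: F0.
  by rewrite /vr mulrC divfK ?gt_eqF// ltrDl divr_gt0.
have rr (r : nat) : r%:R / Q%:R <= r.+1%:R / Q%:R :> R.
  by rewrite ler_pM2r ?invr_gt0// ler_nat.
have hS := covered_bigcup (fun r (_ : (r < Q)%N) => covered_slab (rr r) (hc r)).
apply: coveredS (covered_le _ hS).
  move=> x cx /= Fx; have [r rQ /andP[r1 r2]] := grid_cell (ltn0Sn _ : (0 < Q)%N) (cx k (ltnSn k)).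
  exists r => //; split; last by rewrite r1 r2.
  have := hL x (upd x k (r%:R / Q%:R)).
  rewrite -[X in pdist _ X _](upd_id x k) pdist_upd pdist_eq0 ?add0r; last first.
    by move=> i _; rewrite subrr.
  have : distZ (x k - r%:R / Q%:R) <= Q%:R^-1.
    apply: le_trans (distZ_le_norm _) _; rewrite ger0_norm ?subr_ge0//.
    by move: r2; rewrite -natr1 mulrDl mul1r; lra.
  move=> hn hd; have := le_trans hd (ler_wpM2l L0 hn).
  by rewrite /dl' /Fr ler_norml; move: Fx; lra.
have hr := hmean_rate L0 hL (ltn0Sn _ : (0 < Q)%N).
rewrite (eq_bigr (fun r : 'I_Q => dl'^-1 * (Q%:R^-1 * (hmean k (Fr r) + s / 2)))); last first.
  move=> r _; rewrite /vr.
  have -> : r.+1%:R / Q%:R - r%:R / Q%:R = Q%:R^-1 :> R.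
    by rewrite -mulrBl -natr1 addrAC subrr add0r mul1r.
  ring.
rewrite -mulr_sumr ler_pdivrMl// -mulr_sumr big_split /= sumr_const card_ord mulrDr.
rewrite -[s / 2 *+ Q]mulr_natl mulKf ?gt_eqF//.
move: hr LQ2; rewrite ler_norml /dl' /s -/(Fr _).
set m := Q%:R^-1 * _; set M := hmean k.+1 F; set z := L / Q%:R; lra.
Qed.

End box_covers.

(** * Smallness of the averages off a set of small volume, uniformly in the last coordinate *)

Section small_averages.
Variables (R : realType) (d : nat) (alpha : R) (g : nat -> (nat -> R) -> R).
Local Notation pt := (nat -> R).
Local Notation T := (skewp alpha g).
Hypothesis gdep : triangular g.
Hypothesis glip : tri_lip d g.
Hypothesis gdeg : tri_deg d g.
Hypothesis irr : irrational alpha.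

(** T commutes with rotations of coordinate k, so iterates do not stretch distances along it, and L
    serves for every list of times. *)
Lemma seq_avg_fibre_lip (L : R) k l psi (x : pt) s t : 0 <= L -> lipc L k.+1 psi ->
  `|seq_avg alpha g l psi (upd x k s) - seq_avg alpha g l psi (upd x k t)| <= L * distZ (s - t).
Proof.
move=> L0 h; have Ln : 0 <= L * distZ (s - t) by rewrite mulr_ge0// distZ_ge0.
rewrite /seq_avg -mulrBr -sumrB normrM ger0_norm ?invr_ge0 ?ler0n//.
case: (posnP (size l)) => [->|l0]; first by rewrite invr0 mul0r.
rewrite ler_pdivrMl ?ltr0n//; apply: le_trans (ler_norm_sum _ _ _) _.
apply: le_trans (_ : \sum_(a <- l) (L * distZ (s - t)) <= _); last first.
  by rewrite big_const_seq count_predT iter_addr_0 mulr_natl.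
apply: ler_sum => a _; apply: le_trans (h _ _) _; rewrite ler_wpM2l//.
have -> : upd x k s = shiftc k (s - x k) x by rewrite /shiftc addrCA subrr addr0.
have -> : upd x k t = shiftc k (t - x k) x by rewrite /shiftc addrCA subrr addr0.
rewrite (eq_pdist (x' := shiftc k (s - x k) (iter a T x)) (y' := shiftc k (t - x k) (iter a T x))).
- by rewrite pdist_sh_id opprB addrA subrK.
- by move=> i ik; exact: iter_skewp_sh.
- by move=> i ik; exact: iter_skewp_sh.
Qed.

(** Chebyshev is applied at G grid values of the last coordinate, each with volume v / G and
    threshold dl / 2; the other dl / 2 absorbs the variation between grid points. *)
Lemma small_averages j psi sg (sigma : nat -> nat) i0 (dl v : R) : (j.+1 < d)%N ->
  lip j.+2 psi -> antiperiodic j.+1 sg psi -> (forall n, (n <= sigma n)%N) -> 0 < dl -> 0 < v ->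
  exists l : seq nat, [/\ (0 < size l)%N, all (leq i0) l &
    covered j.+1 v [set x | exists t, dl <= `|seq_avg alpha g (map sigma l) psi (upd x j.+1 t)|]].
Proof.
move=> jd hpsi anti hs dl0 v0.
have [C C0 hC] := banach_saks gdep glip gdeg irr jd hpsi anti hs.
have [L L0 hL] := hpsi.
pose G := (Num.truncn (L / (dl / 2))).+1.
have GR : 0 < G%:R :> R by rewrite ltr0n.
have dl2 : 0 < dl / 2 by rewrite divr_gt0.
have LG : L / G%:R <= dl / 2.
  rewrite ler_pdivrMr// mulrC -ler_pdivrMr//.
  by rewrite ltW// /G truncnS_gt.
pose w := (dl / 2) ^+ 2 * (v / G%:R).
have w0 : 0 < w by rewrite mulr_gt0 ?exprn_gt0 ?divr_gt0.
pose M := (Num.truncn (C / w)).+1.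
have MR : 0 < M%:R :> R by rewrite ltr0n.
have [l [sl al hl]] := hC i0 M.
exists l; split => //; first by rewrite sl.
pose H t x := seq_avg alpha g (map sigma l) psi (upd x j.+1 t).
have hH t : lip j.+1 (H t).
  apply: (lip_upd t (F := seq_avg alpha g (map sigma l) psi)).
  by apply: lipZ; exact: (lip_sum_seq alpha glip).
have hH2 t : hmean j.+1 (fun x => H t x ^+ 2) < w.
  have -> : (fun x => H t x ^+ 2) = (fun x => (M%:R^-1) ^+ 2 *
     (\sum_(a <- map sigma l) psi (iter a T (upd x j.+1 t))) ^+ 2).
    by apply/funext => x; rewrite -exprMn /H /seq_avg size_map sl.
  rewrite hmeanZ; last exact: (lip_sqr (lip_upd t (lip_sum_seq alpha glip _ jd hpsi))).
  rewrite exprVn ltr_pdivrMl ?exprn_gt0//; apply: le_lt_trans (hl t) _.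
  rewrite expr2 -mulrA ltr_pM2l// -ltr_pdivrMr//.
  by rewrite /M truncnS_gt.
have hc (r : nat) : covered j.+1 (v / G%:R) [set x | (dl / 2) ^+ 2 <= H (r%:R / G%:R) x ^+ 2].
  apply: chebyshev_cover => //; first exact: lip_sqr.
  - by move=> x; exact: sqr_ge0.
  - by rewrite exprn_gt0.
have := covered_bigcup (fun r (_ : (r < G)%N) => hc r).
rewrite sumr_const card_ord -[_ *+ G]mulr_natr divfK ?gt_eqF//.
apply: coveredS => x cx [t Ht]; rewrite /=.
have [r rG /andP[r1 r2]] := grid_cell (ltn0Sn _ : (0 < G)%N) (frac_itv t).
exists r => //.
rewrite -[X in _ <= X]real_normK ?num_real// ler_pXn2r ?nnegrE ?(ltW dl2)//.
have := seq_avg_fibre_lip (map sigma l) x t (r%:R / G%:R) L0 hL; rewrite -/(H t x) -/(H _ x).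
have : distZ (t - r%:R / G%:R) <= G%:R^-1.
  rewrite (distZ_eqint (b := Defs.frac t - r%:R / G%:R)); last first.
    by rewrite opprB addrA subrK frac_int.
  apply: le_trans (distZ_le_norm _) _; rewrite ger0_norm ?subr_ge0//.
  by move: r2; rewrite -natr1 mulrDl mul1r; lra.
move=> hn hd; have := le_trans hd (ler_wpM2l L0 hn).
have : dl <= `|H t x| by [].
by move: LG (lerB_dist (H t x) (H (r%:R / G%:R) x)); lra.
Qed.

End small_averages.

(** * Measurability and integration of Lipschitz functions on tuples *)

Section tuple_functions.
Variables (R : realType) (d : nat).
Local Notation pt := (nat -> R).
Implicit Types (x : d.-tuple R) (y : pt) (F G : pt -> R) (L c a b : R).

Definition coords x : pt := nth 0 x.

Lemma coordsE x (i : 'I_d) : coords x i = tnth x i.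
Proof. by rewrite /coords (tnth_nth 0). Qed.

Lemma distZ_le_pdist k (y z : pt) i : (i < k)%N -> distZ (y i - z i) <= pdist k y z.
Proof.
elim: k => [//|k IH]; rewrite pdistS ltnS leq_eqVlt => /orP[/eqP ->|/IH le].
  by rewrite lerDr pdist_ge0.
by apply: le_trans le _; rewrite lerDl distZ_ge0.
Qed.

Lemma distZ_lip a b : `|distZ a - distZ b| <= distZ (a - b).
Proof.
rewrite ler_norml; apply/andP; split.
  by have := distZD (b - a) a; rewrite subrK (distZ_distC b a); lra.
by have := distZD (a - b) b; rewrite subrK; lra.
Qed.

Lemma continuous_distZ : continuous (@distZ R).
Proof.
move=> a; apply/cvgrPdist_le => e e0; near=> b.
apply: le_trans (distZ_lip _ _) _; apply: le_trans (distZ_le_norm _) _.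
by near: b; apply/nbhs_ballP; exists e => //= b; rewrite /ball /= => /ltW.
Unshelve. all: by end_near. Qed.

(** F is the infimum over rational points q of the cones [F q + L * pdist d x q], so a strict
    sublevel set is a countable union of sublevel sets of cones. *)
Lemma measurable_lip F : lip d F -> measurable_fun [set: d.-tuple R] (fun x => F (coords x)).
Proof.
move=> [L L0 h] _; apply: (measurability _ (RGenInftyO.measurableE R)) => //.
move=> _ [_ [c ->] <-]; rewrite setTI.
pose q2p (q : d.-tuple rat) : pt := fun i => ratr (nth 0 q i).
pose S (q : d.-tuple rat) := [set x : d.-tuple R | F (q2p q) + L * pdist d (coords x) (q2p q) < c].
have -> : (fun x => F (coords x)) @^-1` [set` `]-oo, c[] = \bigcup_q S q.
  apply/seteqP; split => [x /=|x [q _] /=]; rewrite in_itv /= => hx; last first.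
    apply: le_lt_trans hx; have := h (coords x) (q2p q); rewrite ler_norml; lra.
  pose e := (c - F (coords x)) / (2 * (L * d%:R + 1)).
  have ld : 0 < L * d%:R + 1 by rewrite ltr_pwDr// mulr_ge0.
  have e0 : 0 < e by rewrite divr_gt0 ?mulr_gt0// subr_gt0.
  have hq (i : 'I_d) : exists q : rat, `|tnth x i - ratr q| <= e.
    have [|q] := @rat_in_itvoo R (tnth x i - e) (tnth x i + e); first by lra.
    by rewrite in_itv /= => q1; exists q; rewrite ler_norml; lra.
  have [qf hqf] := choice hq.
  exists [tuple qf i | i < d] => //=; rewrite /S /=.
  set q := q2p _.
  have pd : pdist d (coords x) q <= d%:R * e.
    rewrite /pdist; apply: le_trans (_ : \sum_(i < d) e <= _); last first.
      by rewrite sumr_const card_ord mulr_natl.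
    apply: ler_sum => i _; apply: le_trans (distZ_le_norm _) _.
    by rewrite coordsE /q /q2p -tnth_nth tnth_mktuple.
  have h1 := h (coords x) q; have h2 : L * pdist d (coords x) q <= L * (d%:R * e) by rewrite ler_wpM2l.
  have h3 : L * (d%:R * e) < (c - F (coords x)) / 2.
    rewrite (_ : (c - F (coords x)) / 2 = (L * d%:R + 1) * e).
      by rewrite mulrDl mul1r mulrA ltrDl.
    by rewrite /e; field; rewrite gt_eqF.
  move: h1; rewrite ler_norml; lra.
apply: countable_bigcupT_measurable => // q.
have mf : measurable_fun [set: d.-tuple R] (fun x => F (q2p q) + L * pdist d (coords x) (q2p q)).
  apply: measurable_funD => //; apply: measurable_funM => //.
  apply: measurable_sum => i.
  apply: (@measurableT_comp _ _ _ _ _ _ (@distZ R)).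
    exact: continuous_measurable_fun continuous_distZ.
  apply: measurable_funB => //.
  by under eq_fun do rewrite coordsE; exact: measurable_tnth.
rewrite -[S q]setTI
  (_ : S q = (fun x => F (q2p q) + L * pdist d (coords x) (q2p q)) @^-1` [set` `]-oo, c[]).
  by apply: mf => //; exact: measurable_itv.
by apply/seteqP; split => x /=; rewrite in_itv.
Qed.

(** For c < 1 the arc [0, c] is the closed ball of radius c / 2 about c / 2; for c >= 1 both sides
    fail. This trades the discontinuous fractional part for a Lipschitz function. *)
Lemma frac_gtE a c : 0 <= c -> (c < Defs.frac a) = (c / 2 < distZ (a - c / 2)).
Proof.
move=> c0; have fa := frac_itv a.
rewrite (@distZ_eqint _ (a - c / 2) (Defs.frac a - c / 2)); last first.
  by rewrite opprB addrA subrK frac_int.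
have [lt|le] := ltP c (Defs.frac a); apply/esym.
  have [z /intrP[m ->] ->] := distZE (Defs.frac a - c / 2).
  have [m0|m1] := leP m 0.
    have : m%:~R <= 0 :> R by rewrite -[0]/(0%:~R) ler_int.
    by move=> mR; rewrite ger0_norm; lra.
  have : 1 <= m%:~R :> R by rewrite -[1]/(1%:~R) ler_int.
  by move=> mR; rewrite ler0_norm; lra.
apply/negbTE; rewrite -leNgt; apply: le_trans (distZ_le_norm _) _.
by rewrite ler_norml; lra.
Qed.

Lemma measurable_frac_lip (h : pt -> R) L : 0 <= L ->
  (forall y z, distZ (h y - h z) <= L * pdist d y z) ->
  measurable_fun [set: d.-tuple R] (fun x => Defs.frac (h (coords x))).
Proof.
move=> L0 hL _; apply: (measurability _ (RGenOInfty.measurableE R)) => //.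
move=> _ [_ [c ->] <-]; rewrite setTI.
have [c0|c0] := leP 0 c; last first.
  rewrite (_ : _ @^-1` _ = setT); first exact: measurableT.
  apply/seteqP; split => x //= _; rewrite in_itv /= andbT.
  by have := frac_itv (h (coords x)); lra.
have hl : lip d (fun y => distZ (h y - c / 2)).
  exists L => // y z; apply: le_trans (distZ_lip _ _) _.
  by rewrite opprB addrA subrK.
have := measurable_lip hl measurableT (measurable_itv `]c / 2, +oo[).
rewrite setTI; congr measurable; apply/seteqP; split => x /=;
  by rewrite !in_itv /= !andbT frac_gtE.
Qed.

Lemma lip_torus_continuous F : lip d F -> torus_continuous (fun x => F (coords x)).
Proof.
move=> hF; split => [x y xy|x e e0].
  apply: (lip_dep hF) => i id; have := xy (Ordinal id).
  by rewrite -!coordsE.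
have [L L0 hL] := hF; pose dl := e / (L * d%:R + 1).
have ld : 0 < L * d%:R + 1 by rewrite ltr_pwDr// mulr_ge0.
have dl0 : 0 < dl by rewrite divr_gt0.
exists dl => // y hy; apply: le_lt_trans (hL _ _) _.
have : pdist d (coords y) (coords x) <= d%:R * dl.
  apply: le_trans (_ : \sum_(i < d) dl <= _); last by rewrite sumr_const card_ord mulr_natl.
  apply: ler_sum => i _; apply: le_trans (distZ_le_norm _) _.
  by rewrite !coordsE ltW.
move=> /(ler_wpM2l L0) /le_lt_trans; apply.
have <- : (L * d%:R + 1) * dl = e by rewrite /dl mulrC divfK// gt_eqF.
by rewrite mulrDl mul1r mulrA ltrDl.
Qed.

Variable P : probability (d.-tuple R) R.

Definition pint F : R := \int[P]_x F (coords x).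

Lemma lip_integrable F : lip d F -> P.-integrable setT (EFin \o (fun x => F (coords x))).
Proof.
move=> h; apply: measurable_bounded_integrable => //.
- by rewrite [X in (X < _)%E](_ : _ = 1%E) ?ltry//; exact: probability_setT.
- exact: (measurable_lip h).
have [C C0 hC] := lip_bound h; exists C; split; first exact: num_real.
by move=> M CM x _; apply: le_trans (hC _) (ltW CM).
Qed.

Lemma integral_lip F : lip d F -> (\int[P]_x (F (coords x))%:E)%E = (pint F)%:E.
Proof.
move=> h; rewrite /pint /Rintegral fineK//.
exact: (integrable_fin_num measurableT (lip_integrable h)).
Qed.

Lemma pintD F G : lip d F -> lip d G -> pint (fun y => F y + G y) = pint F + pint G.
Proof. by move=> hF hG; rewrite /pint RintegralD//; exact: lip_integrable. Qed.

Lemma pintZ c F : lip d F -> pint (fun y => c * F y) = c * pint F.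
Proof. by move=> hF; rewrite /pint RintegralZl//; exact: lip_integrable. Qed.

Lemma pintB F G : lip d F -> lip d G -> pint (fun y => F y - G y) = pint F - pint G.
Proof. by move=> hF hG; rewrite /pint RintegralB//; exact: lip_integrable. Qed.

Lemma pint_cst c : pint (fun=> c) = c.
Proof.
rewrite /pint Rintegral_cst// (_ : fine _ = 1) ?mulr1//.
by have /(congr1 fine) := probability_setT P.
Qed.

Lemma pint_norm_le F c : lip d F -> (forall y, `|F y| <= c) -> `|pint F| <= c.
Proof.
move=> h hc; apply: le_trans (le_normr_Rintegral _ (lip_integrable h)) _ => //.
rewrite -[X in _ <= X]pint_cst; apply: le_Rintegral => //.
- exact: (lip_integrable (lip_norm h)).
- exact: (lip_integrable (lip_cst _ c)).
Qed.

Lemma pint_sum_seq (I : Type) (l : seq I) (F : I -> pt -> R) : (forall i, lip d (F i)) ->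
  pint (fun y => \sum_(i <- l) F i y) = \sum_(i <- l) pint (F i).
Proof.
move=> h; suff [] : lip d (fun y => \sum_(i <- l) F i y) /\
  pint (fun y => \sum_(i <- l) F i y) = \sum_(i <- l) pint (F i) by [].
elim: l => [|i l [IH1 IH2]].
  by under eq_fun do rewrite big_nil; split; [exact: lip_cst|rewrite pint_cst big_nil].
under eq_fun do rewrite big_cons; rewrite big_cons -IH2 pintD//; split => //.
exact: lipD.
Qed.

End tuple_functions.

(** * Borel-Cantelli for box covers *)

Section null_sets.
Variables (R : realType) (k : nat).
Local Notation pt := (nat -> R).
Implicit Types (y : k.-tuple R) (l : seq (pt * pt)).

Definition boxes l : set (k.-tuple R) := [set y | has (fun b => inbox k b (coords y)) l].

Lemma measurable_boxes l : measurable (boxes l).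
Proof.
elim: l => [|b l IH].
  by rewrite (_ : boxes [::] = set0)//; apply/seteqP; split.
rewrite (_ : boxes (b :: l) =
    (\bigcap_(i in [set: 'I_k]) (fun y => tnth y i) @^-1` [set` `[b.1 i, b.2 i[]) `|` boxes l).
  apply: measurableU => //; apply: fin_bigcap_measurable => // i _.
  by rewrite -[X in measurable X]setTI; apply: measurable_tnth => //; exact: measurable_itv.
apply/seteqP; split => y; rewrite /boxes /=.
  move=> /orP[/forallP h|h]; [left => i _ /=|by right].
  by rewrite in_itv /= -coordsE; exact: h.
move=> [h|->]; last by rewrite orbT.
apply/orP; left; apply/forallP => i; have := h i Logic.I.
by rewrite /= in_itv /= -coordsE.
Qed.

Lemma nth_flatten_take (T : Type) (x0 : T) (s : nat -> seq T) p q n : (p <= q)%N ->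
  (n < size (flatten (map s (iota 0 p))))%N ->
  nth x0 (flatten (map s (iota 0 q))) n = nth x0 (flatten (map s (iota 0 p))) n.
Proof.
by move=> pq np; rewrite -{1}(subnKC pq) iotaD map_cat flatten_cat nth_cat np.
Qed.

(** The lists from index m on cover the limsup, with total volume at most 2 * 2^-m; the work lies in
    enumerating their boxes as one sequence. *)
Lemma limsup_boxes_null (lst : nat -> seq (pt * pt)) : (0 < k)%N ->
  (forall i, \sum_(b <- lst i) volb k b <= 2^-1 ^+ i) ->
  lebesgue_null (lim_sup_set (fun i => boxes (lst i))).
Proof.
move=> k0 hv e e0.
have [m hm] : exists m : nat, 2 * 2^-1 ^+ m <= e.
  pose m := (Num.truncn (2 / e)).+1; exists m.
  have : 2 / e < m%:R by rewrite /m truncnS_gt.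
  rewrite ltr_pdivrMr// exprVn ler_pdivrMr ?exprn_gt0// => h.
  apply: le_trans (ltW h) _; rewrite mulrC ler_wpM2l ?(ltW e0)//.
  by rewrite -natrX ler_nat ltnW// ltn_expl.
(* A box of volume 0 put in front of each list gives [fl n] at least n entries, so
   [nth z (fl n.+1) n] is a true entry even if lists are empty. *)
pose z : pt * pt := (fun=> 0, fun=> 0).
pose s i := z :: lst (m + i)%N.
pose fl n := flatten (map s (iota 0 n)).
have vz : volb k z = 0.
  by rewrite /volb (bigD1 (Ordinal k0)) //= subrr maxxx mul0r.
have flS n : fl n.+1 = fl n ++ s n.
  by rewrite /fl -addn1 iotaD map_cat flatten_cat /= cats0.
have szf n : (n <= size (fl n))%N.
  by elim: n => [//|n IH]; rewrite flS size_cat /= addnS ltnS (leq_trans IH)// leq_addr.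
have vf n : \sum_(b <- fl n) volb k b <= 2 * 2^-1 ^+ m.
  suff : \sum_(b <- fl n) volb k b <= 2 * 2^-1 ^+ m - 2 * 2^-1 ^+ (m + n).
    by move/le_trans; apply; rewrite gerBl mulr_ge0// exprn_ge0// invr_ge0.
  elim: n => [|n IH]; first by rewrite /fl /= big_nil addn0 subrr.
  rewrite flS big_cat /= big_cons vz add0r addnS exprS.
  have := hv (m + n)%N; move: IH; set u := 2^-1 ^+ (m + n); lra.
pose ab n := nth z (fl n.+1) n.
exists (fun n => [tuple (ab n).1 i | i < k]), (fun n => [tuple (ab n).2 i | i < k]); split.
  move=> y /(_ m Logic.I)[i /= mi yi].
  have hs : has (fun b => inbox k b (coords y)) (fl (i - m).+1).
    by rewrite flS has_cat /= subnKC// yi !orbT.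
  pose n := find (fun b => inbox k b (coords y)) (fl (i - m).+1).
  have nlt : (n < size (fl (i - m).+1))%N by rewrite -has_find.
  exists n => // c; rewrite !tnth_mktuple -coordsE.
  have -> : ab n = nth z (fl (i - m).+1) n.
    have [le|lt] := leqP n.+1 (i - m).+1.
      by rewrite /ab [RHS](nth_flatten_take _ le)//; exact: szf.
    by rewrite /ab (nth_flatten_take _ (ltnW lt)).
  by have /forallP := nth_find z hs; exact.
move=> N; apply: le_trans hm; apply: le_trans (vf N).
have -> : \sum_(n < N) box_vol [tuple (ab n).1 i | i < k] [tuple (ab n).2 i | i < k] =
    \sum_(b <- take N (fl N)) volb k b.
  rewrite (big_nth z) size_takel ?szf// big_mkord; apply: eq_bigr => n _.
  rewrite nth_take//.
  have -> : nth z (fl N) n = ab n by apply: (nth_flatten_take z (ltn_ord n)); exact: szf.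
  by apply: eq_bigr => i _; rewrite !tnth_mktuple.
rewrite -[X in _ <= \sum_(b <- X) _](cat_take_drop N) big_cat /= lerDl.
by apply: sumr_ge0 => b _; exact: volb_ge0.
Qed.

End null_sets.

(** * Dominated convergence for integrals of Lipschitz functions *)

Section limits_of_integrals.
Variables (R : realType) (d : nat) (P : probability (d.-tuple R) R).
Local Notation pt := (nat -> R).

Lemma pint_cvg (F : nat -> pt -> R) (G : d.-tuple R -> R) (C : R) :
  (forall n, lip d (F n)) -> (forall n y, `|F n y| <= C) -> measurable_fun setT G ->
  {ae P, forall x, (fun n => F n (coords x)) @ \oo --> G x} ->
  (fun n => pint P (F n)) @ \oo --> \int[P]_x G x.
Proof.
move=> hF hC mG hae.
have [] := @dominated_convergence _ _ _ P setT measurableT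
  (fun n x => (F n (coords x))%:E) (EFin \o G) (fun=> C%:E).
- by move=> n; apply/measurable_EFinP; exact: measurable_lip.
- exact/measurable_EFinP.
- apply: filterS hae => x hx _; apply: cvg_EFin; first by near=> n.
  exact: hx.
- exact: (finite_measure_integrable_cst P C measurableT).
- by apply: aeW => x n _; rewrite /= lee_fin hC.
move=> iG _ hcv.
have fG : (\int[P]_x (G x)%:E)%E \is a fin_num by exact: (integrable_fin_num measurableT iG).
have := @fine_cvg _ _ _ _ (fun n => \int[P]_x (F n (coords x))%:E)%E (\int[P]_x G x).
rewrite /Rintegral fineK//; exact.
Unshelve. all: by end_near. Qed.

Lemma Rintegral_indic (A : set (d.-tuple R)) : measurable A ->
  \int[P]_x (\1_A x : R) = fine (P A).
Proof. by move=> mA; rewrite /Rintegral integral_indic// setIT. Qed.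

End limits_of_integrals.

(** * Open orthants as a generating pi-system *)

Section orthants.
Variables (R : realType) (d : nat).
Implicit Types (x : d.-tuple R) (c : nat -> R).

Definition orthant c : set (d.-tuple R) := [set x | forall i : 'I_d, c i < tnth x i].

Definition orthants : set (set (d.-tuple R)) := range orthant.

Lemma orthants_setI : setI_closed orthants.
Proof.
move=> _ _ [a _ <-] [b _ <-]; exists (fun i => Num.max (a i) (b i)) => //.
apply/seteqP; split => x /=.
  by move=> h; split => i; have := h i; rewrite gt_max => /andP[].
by move=> [ha hb] i; rewrite gt_max ha hb.
Qed.

Lemma orthants_cover : \bigcup_n orthant (fun=> - n%:R) = setT.
Proof.
apply/seteqP; split => x // _.
pose M := \sum_(i < d) `|tnth x i|.
exists (Num.truncn M).+1 => // i.
have : M < (Num.truncn M).+1%:R by rewrite truncnS_gt.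
have : `|tnth x i| <= M by rewrite /M (bigD1 i) //= lerDl sumr_ge0.
have := ler_norm (- tnth x i); rewrite normrN; lra.
Qed.

Lemma measurable_orthants : (@measurable _ (d.-tuple R)) = <<s orthants >>.
Proof.
apply/seteqP; split; last first.
  apply: smallest_sub; first exact: sigma_algebra_measurable.
  move=> _ [c _ <-].
  rewrite (_ : orthant c = \bigcap_(i in [set: 'I_d]) (fun x => tnth x i) @^-1` [set` `]c i, +oo[]).
    apply: fin_bigcap_measurable => // i _.
    by rewrite -[X in measurable X]setTI; apply: measurable_tnth => //; exact: measurable_itv.
  apply/seteqP; split => x /= h i; first by move=> _ /=; rewrite in_itv /= andbT.
  by have := h i Logic.I; rewrite /= in_itv /= andbT.
pose GT := g_sigma_algebraType orthants.
have mid : measurable_fun [set: GT] (id : GT -> d.-tuple R).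
  apply/measurable_fun_tnthP => i _; apply: (measurability _ (RGenOInfty.measurableE R)) => //.
  move=> _ [_ [a ->] <-]; rewrite setTI.
  (* Letting the bounds on the other coordinates tend to minus infinity exhausts a half-space by
     orthants. *)
  pose c n (l : nat) := if l == i then a else - n%:R : R.
  rewrite [X in measurable X](_ : _ = \bigcup_n (orthant (c n) : set GT)).
    by apply: bigcupT_measurable => n; apply: sub_sigma_algebra; exists (c n).
  apply/seteqP; split => x /=; rewrite in_itv /= andbT.
    move=> ax; have : (\bigcup_n orthant (fun=> - n%:R)) x by rewrite orthants_cover.
    move=> [n _ hn]; exists n => // l; rewrite /c; case: eqP => [/ord_inj -> //|_].
    exact: hn.
  by move=> [n _ /(_ i)]; rewrite /c eqxx.
by move=> A mA; have := mid measurableT A mA; rewrite setTI.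
Qed.

End orthants.

(** * From invariance of Lipschitz integrals to invariance of the measure *)

Section rotation_invariance.
Variable R : realType.
Local Notation pt := (nat -> R).
Implicit Types (a b c : R) (m : nat).

(** Lipschitz functions on the circle that tend, as m grows, to the indicator of [c < frac a], in
    the form given by [frac_gtE]; for c < 0 that indicator is constantly 1. *)
Definition arc_bump c m a : R :=
  if c < 0 then 1 else Num.min 1 (m%:R * Num.max 0 (distZ (a - c / 2) - c / 2)).

Lemma arc_bump_itv c m a : 0 <= arc_bump c m a <= 1.
Proof.
rewrite /arc_bump; case: ifP => _; first by rewrite ler01 lexx.
by rewrite le_min ler01 /= ge_min lexx mulr_ge0 ?ler0n// le_max lexx.
Qed.

Lemma min1_lip a b : `|Num.min 1 a - Num.min 1 b| <= `|a - b|.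
Proof.
rewrite !minEle; do 2 case: ifP => ?; rewrite !ler_norml;
  by have := ler_norm (a - b); have := ler_norm (- (a - b)); rewrite normrN; lra.
Qed.

Lemma max0_lip a b : `|Num.max 0 a - Num.max 0 b| <= `|a - b|.
Proof.
rewrite !maxEle; do 2 case: ifP => ?; rewrite !ler_norml;
  by have := ler_norm (a - b); have := ler_norm (- (a - b)); rewrite normrN; lra.
Qed.

Lemma arc_bump_lip c m a b : `|arc_bump c m a - arc_bump c m b| <= m%:R * distZ (a - b).
Proof.
rewrite /arc_bump; case: ifP => _; first by rewrite subrr normr0 mulr_ge0// distZ_ge0.
apply: le_trans (min1_lip _ _) _; rewrite -mulrBr normrM normr_nat ler_wpM2l//.
apply: le_trans (max0_lip _ _) _; rewrite opprB addrA subrK.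
by apply: le_trans (distZ_lip _ _) _; rewrite opprB addrA subrK.
Qed.

Lemma arc_bump_near c a : \forall m \near \oo, arc_bump c m a = (c < Defs.frac a)%R%:R.
Proof.
rewrite /arc_bump; have [c0|c0] := ltP c 0.
  by near=> m; have -> : c < Defs.frac a by have := frac_itv a; lra.
rewrite frac_gtE//; have [lt|le] := ltP (c / 2) (distZ (a - c / 2)); last first.
  near=> m; rewrite max_l ?mulr0 ?min_r//; lra.
pose u := distZ (a - c / 2) - c / 2; have u0 : 0 < u by rewrite subr_gt0.
exists (Num.truncn u^-1).+1 => // m /= hm.
rewrite max_r ?(ltW u0)// min_l//.
rewrite -ler_pdivrMr// mul1r; apply: le_trans (_ : (Num.truncn u^-1).+1%:R <= _).
  by rewrite ltW// truncnS_gt.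
by rewrite ler_nat.
Unshelve. all: by end_near. Qed.

Variable d : nat.

Lemma lip_prod k n (F : nat -> pt -> R) : (forall i, (i < n)%N -> lip k (F i)) ->
  lip k (fun y => \prod_(i < n) F i y).
Proof.
elim: n => [|n IH] h; first by under eq_fun do rewrite big_ord0; exact: lip_cst.
under eq_fun do rewrite big_ord_recr /=.
by apply: lipM; [apply: IH => i ?; apply: h; rewrite ltnS ltnW|exact: h].
Qed.

Definition arc_bumps (c : pt) m (y : pt) : R := \prod_(i < d) arc_bump (c i) m (y i).

Lemma lip_arc_bumps (c : pt) m : lip d (arc_bumps c m).
Proof.
apply: (lip_prod (F := fun i y => arc_bump (c i) m (y i))) => i id.
exists m%:R => // y z; apply: le_trans (arc_bump_lip _ _ _ _) _.
by rewrite ler_wpM2l// distZ_le_pdist.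
Qed.

Lemma bumps_le (c : pt) m y : `|arc_bumps c m y| <= 1.
Proof.
rewrite /arc_bumps normr_prod; apply: Num.Theory.prodr_ile1 => i _; rewrite normr_ge0 /=.
by have /andP[b0 b1] := arc_bump_itv (c i) m (y i); rewrite ger0_norm.
Qed.

Lemma tnth_rot_last t (x : d.-tuple R) i :
  tnth (rot_last t x) i = Defs.frac (shiftc d.-1 t (coords x) i).
Proof.
by rewrite tnth_mktuple /shiftc /upd /coords; case: eqP => // ->.
Qed.

Lemma measurable_rot_last t : measurable_fun [set: d.-tuple R] (@rot_last R d t).
Proof.
apply/measurable_fun_tnthP => i.
rewrite (_ : _ \o _ = fun x => Defs.frac (shiftc d.-1 t (coords x) i)); last first.
  by apply/funext => x /=; rewrite tnth_rot_last.
apply: (@measurable_frac_lip _ _ (fun y => shiftc d.-1 t y i) 1) => // y z.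
by rewrite mul1r -(pdist_sh _ d.-1 t); exact: distZ_le_pdist.
Qed.

Lemma measurable_orthant (c : pt) : measurable (orthant c : set (d.-tuple R)).
Proof. by rewrite measurable_orthants; apply: sub_sigma_algebra; exists c. Qed.

Variable P : probability (d.-tuple R) R.
Hypothesis P0 : P (~` @fund_dom R d) = 0%E.
Hypothesis Psh : forall F t, lip d F -> pint P (fun y => F (shiftc d.-1 t y)) = pint P F.

Lemma pint_arc_bumps_cvg (c : pt) t :
  (fun m => pint P (fun y => arc_bumps c m (shiftc d.-1 t y))) @ \oo -->
  fine (P (rot_last t @^-1` orthant c)).
Proof.
have mS : measurable (rot_last t @^-1` (orthant c : set (d.-tuple R))).
  by rewrite -[X in measurable X]setTI; apply: measurable_rot_last => //; exact: measurable_orthant.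
rewrite -Rintegral_indic//.
apply: (@pint_cvg _ _ _ (fun m y => arc_bumps c m (shiftc d.-1 t y)) _ 1).
- by move=> m; apply: lip_sh; exact: lip_arc_bumps.
- by move=> m y; exact: bumps_le.
- exact: measurable_indic.
apply: aeW => x; apply: cvg_near_cst.
have : \forall m \near \oo, forall i : 'I_d,
    arc_bump (c i) m (shiftc d.-1 t (coords x) i) = (c i < Defs.frac (shiftc d.-1 t (coords x) i))%R%:R.
  by apply: filter_forall => i; exact: arc_bump_near.
apply: filterS => m hm; rewrite /arc_bumps (eq_bigr _ (fun i _ => hm i)) indicE.
have [/set_mem xS|xS] := boolP (x \in _).
  by rewrite big1// => i _; have := xS i; rewrite tnth_rot_last => ->.
have [i ci] : exists i : 'I_d, ~~ (c i < tnth (rot_last t x) i).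
  apply/existsP; rewrite -negb_forall; apply: contra xS => /forallP h.
  by apply/mem_set => i; exact: h.
by rewrite (bigD1 i) //= -tnth_rot_last (negbTE ci) mul0r.
Qed.

Lemma measurable_fund_dom : measurable (@fund_dom R d).
Proof.
rewrite (_ : @fund_dom R d = \bigcap_(i in [set: 'I_d]) (fun x => tnth x i) @^-1` [set` `[0, 1[]).
  apply: fin_bigcap_measurable => // i _.
  by rewrite -[X in measurable X]setTI; apply: measurable_tnth => //; exact: measurable_itv.
apply/seteqP; split => x /= h i; first by move=> _ /=; rewrite in_itv /=; exact: h.
by have := h i Logic.I; rewrite /= in_itv.
Qed.

Lemma eq_prob_fund_dom (A B : set (d.-tuple R)) : measurable A -> measurable B ->
  (forall x, fund_dom x -> A x <-> B x) -> P A = P B.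
Proof.
have red C : measurable C -> P C = P (C `&` @fund_dom R d).
  move=> mC; rewrite -{1}(setUIDK C (@fund_dom R d)) measureU0//.
  - by apply: measurableI => //; exact: measurable_fund_dom.
  - by apply: measurableD => //; exact: measurable_fund_dom.
  - apply: subset_measure0 P0 => //.
    + by apply: measurableD => //; exact: measurable_fund_dom.
    + by apply: measurableC; exact: measurable_fund_dom.
move=> mA mB AB; rewrite (red A)// (red B)//; congr (P _).
by apply/seteqP; split => x [h fx]; split => //; apply/(AB x fx).
Qed.

Lemma rot_last_invariant t (A : set (d.-tuple R)) : measurable A -> P (rot_last t @^-1` A) = P A.
Proof.
have mrot s (C : set (d.-tuple R)) : measurable C -> measurable (rot_last s @^-1` C).
  by move=> mC; rewrite -[X in measurable X]setTI; apply: measurable_rot_last.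
have finP (C : set (d.-tuple R)) : measurable C -> P C \is a fin_num.
  by move=> mC; exact: fin_num_measure.
have orth (c : pt) : P (rot_last t @^-1` orthant c) = P (orthant c).
  have mc := measurable_orthant c.
  (* The bumps see only fractional parts, so the comparison is with the rotation by 0, which is the
     identity on the fundamental domain and thus almost everywhere. *)
  transitivity (P (rot_last 0 @^-1` orthant c)).
    rewrite -[LHS]fineK ?finP//; last exact: mrot.
    rewrite -[RHS]fineK ?finP//; last exact: mrot.
    congr EFin; have h1 := @pint_arc_bumps_cvg c t; have h2 := @pint_arc_bumps_cvg c 0.
    rewrite -(cvg_lim (@Rhausdorff R) h1) -(cvg_lim (@Rhausdorff R) h2).
    suff -> : (fun m => pint P (fun y => arc_bumps c m (shiftc d.-1 t y))) =
        (fun m => pint P (fun y => arc_bumps c m (shiftc d.-1 0 y))) by [].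
    by apply/funext => m; rewrite !Psh//; exact: lip_arc_bumps.
  apply: eq_prob_fund_dom => //; first exact: mrot.
  move=> x fx; have e i : tnth (rot_last 0 x) i = tnth x i.
    by rewrite tnth_rot_last shiftc0 coordsE frac_id.
  by split => h i; have := h i; rewrite e.
move=> mA.
have [:mr] @m2 : {measure set (d.-tuple R) -> \bar R}.
  refine (measure_function_pushforward__canonical__measure_function_Measure P _).
  abstract: mr; exact: (measurable_rot_last t).
apply: (measure_unique (@orthants R d) (fun n => orthant (fun=> - n%:R)) _ _ _ _ m2 P) => //.
- exact: measurable_orthants.
- exact: orthants_setI.
- by move=> n; exists (fun=> - n%:R).
- exact: orthants_cover.
- by move=> _ [c _ <-]; exact: orth.
- move=> n; rewrite /m2 /= /pushforward orth.
  by rewrite ltey_eq finP//; exact: measurable_orthant.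
Qed.

End rotation_invariance.

(** * Comparison of [skew_map] with its unreduced version *)

Section lifted_skew_map.
Variables (R : realType) (d : nat) (alpha : R) (f : forall k : nat, k.+1.-tuple R -> R).
Local Notation pt := (nat -> R).
Implicit Types (x : d.-tuple R) (y : pt) (k n i : nat).

Definition lift_maps k y : R := f [tuple y l | l < k.+1].
Local Notation g := lift_maps.
Local Notation T := (skewp alpha g).

Lemma triangular_lift : triangular g.
Proof.
move=> i y z h; congr f; apply: eq_from_tnth => l; rewrite !tnth_mktuple.
by apply: h; rewrite -ltnS.
Qed.

Lemma tri_lip_lift : (forall k, (k.+1 < d)%N -> torus_lipschitz (@f k)) -> tri_lip d g.
Proof.
move=> h i id; have [L hL] := h i id; exists `|L| => // y z.
have := hL [tuple y l | l < i.+1] [tuple z l | l < i.+1]; rewrite tdistE => /le_trans; apply.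
set D := tdistn _ _; have D0 : 0 <= D.
  rewrite /D /tdistn; elim/big_ind: _ => // [a b a0 _|l _]; first by rewrite le_max a0.
  by rewrite tdistE distZ_ge0.
apply: le_trans (_ : `|L| * D <= _); first by rewrite ler_wpM2r// ler_norm.
rewrite ler_wpM2l//; apply: bigmax_le => [|l _]; first exact: pdist_ge0.
by rewrite tdistE !tnth_mktuple; exact: distZ_le_pdist.
Qed.

Lemma tri_deg_lift : (forall k, (k.+1 < d)%N -> forall x' : k.-tuple R,
    loop_nontrivial (fun t => f [tuple of rcons x' t])) -> tri_deg d g.
Proof.
move=> h j jd; have [m [m0 [H [cH [hH Hm]]]]] := h j jd [tuple of nseq j 0].
exists H, m; split => // u; have := hH u; rewrite /eqZ /lift_maps.
congr (_ - f _ \is a _); apply: eq_from_tnth => l.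
rewrite tnth_mktuple (tnth_nth 0) /= nth_rcons size_nseq nth_nseq /upd.
have := ltn_ord l; rewrite ltnS leq_eqVlt => /orP[/eqP ->|lj]; first by rewrite ltnn eqxx.
by rewrite lj (ltn_eqF lj).
Qed.

Lemma coords_skew_map x i : (i < d)%N ->
  coords (skew_map alpha f x) i = Defs.frac (T (coords x) i).
Proof. by move=> id; rewrite (coordsE _ (Ordinal id)) tnth_mktuple; case: i id. Qed.

Hypothesis glip : tri_lip d g.

(** The Lipschitz bound for T in [pdist] makes T respect congruence modulo 1, so reducing after each
    step is harmless. *)
Lemma iter_skew_map_int n x i : (i < d)%N ->
  coords (iter n (skew_map alpha f) x) i - iter n T (coords x) i \is a Num.int.
Proof.
elim: n i => [|n IH] i id; first by rewrite subrr.
rewrite !iterS coords_skew_map//; set z := iter n _ x in IH *; set w := iter n T _ in IH *.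
have [M M0 hM] := pdist_skewp alpha glip (leqnn d).
have : T (coords z) i - T w i \is a Num.int.
  apply: distZ_eq0; apply/eqP; rewrite eq_le distZ_ge0 andbT.
  apply: le_trans (distZ_le_pdist _ _ id) _; apply: le_trans (hM _ _) _.
  by rewrite pdist_eq0 ?mulr0.
move=> h; apply: (eq_int (rpredB h (frac_int (T (coords z) i)))); ring.
Qed.

Lemma lip_iter_skew_map n x psi : lip d psi ->
  psi (coords (iter n (skew_map alpha f) x)) = psi (iter n T (coords x)).
Proof. by move=> h; apply: (lip_dep h) => i; exact: iter_skew_map_int. Qed.

Lemma measurable_skew_map : measurable_fun [set: d.-tuple R] (skew_map alpha f).
Proof.
apply/measurable_fun_tnthP => i.
rewrite (_ : _ \o _ = fun x => Defs.frac (T (coords x) i)); last first.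
  by apply/funext => x /=; rewrite -coordsE coords_skew_map.
have [M M0 hM] := pdist_skewp alpha glip (leqnn d).
apply: (@measurable_frac_lip _ _ (fun y => T y i) M) => // y z.
by apply: le_trans (distZ_le_pdist _ _ _) (hM _ _).
Qed.

Lemma measurable_iter_skew_map n : measurable_fun [set: d.-tuple R] (iter n (skew_map alpha f)).
Proof.
elim: n => [|n IH]; first exact: measurable_id.
by apply: (measurableT_comp measurable_skew_map IH).
Qed.

Lemma integral_iter_skew_map (P : probability (d.-tuple R) R) n psi : lip d psi ->
  (\int[pushforward P (iter n (skew_map alpha f))]_x (psi (coords x))%:E)%E =
    (pint P (fun y => psi (iter n T y)))%:E.
Proof.
move=> h; have hn : lip d (fun y => psi (iter n T y)) by exact: (lip_iter alpha glip).
have e : (fun x => (psi (coords x))%:E) \o iter n (skew_map alpha f) =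
    (fun x => (psi (iter n T (coords x)))%:E).
  by apply/funext => x /=; rewrite lip_iter_skew_map.
rewrite (@integral_pushforward _ _ _ _ _ _ (measurable_iter_skew_map n) P setT)//.
- by rewrite preimage_setT e -(integral_lip P hn).
- by apply/measurable_EFinP; exact: measurable_lip.
- by rewrite preimage_setT e; exact: (lip_integrable P hn).
Qed.

End lifted_skew_map.

(** * Limit points annihilate antiperiodic functions *)

Section limit_points.
Variables (R : realType) (j : nat) (alpha : R) (g : nat -> (nat -> R) -> R).
Local Notation d := j.+2.
Local Notation pt := (nat -> R).
Local Notation T := (skewp alpha g).

Hypothesis gdep : triangular g.
Hypothesis glip : tri_lip d g.
Hypothesis gdeg : tri_deg d g.
Hypothesis irr : irrational alpha.

Variables mu nu : probability (d.-tuple R) R.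
Hypothesis mu0 : mu (~` @fund_dom R d) = 0%E.
Hypothesis muac : forall A : set (j.+1.-tuple R), measurable A -> lebesgue_null A ->
  mu (@proj_init R d @^-1` A) = 0%E.

Variable sigma : nat -> nat.
Hypothesis sigma_ge : forall n, (n <= sigma n)%N.
Hypothesis sigma_cvg : forall psi, lip d psi ->
  (fun n => pint mu (fun y => psi (iter (sigma n) T y))) @ \oo --> pint nu psi.

Lemma coords_proj_init (x : d.-tuple R) i : (i < j.+1)%N -> coords (proj_init x) i = coords x i.
Proof. by move=> ij; rewrite (coordsE _ (Ordinal ij)) tnth_mktuple. Qed.

Lemma measurable_proj_init : measurable_fun [set: d.-tuple R] (@proj_init R d).
Proof.
apply/measurable_fun_tnthP => i.
have id : (i < d)%N by apply: leq_trans (ltn_ord i) _; exact: leqnSn.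
rewrite (_ : _ \o _ = fun x => tnth x (Ordinal id)); first exact: measurable_tnth.
by apply/funext => x /=; rewrite -!coordsE coords_proj_init.
Qed.

(** The [mu]-integrals of the averages [H i] have two limits: 0, since [H i] tends to 0 almost
    everywhere by Borel-Cantelli, and the [nu]-integral of psi, since [H i] averages members of
    index at least i of a convergent sequence. *)
Lemma pint_antiperiodic psi sg : lip d psi -> antiperiodic j.+1 sg psi -> pint nu psi = 0.
Proof.
move=> hpsi anti; have [C C0 bC] := lip_bound hpsi.
pose bad (l : seq nat) (e : R) := [set y : pt | exists t : R,
  e <= `|seq_avg alpha g (map sigma l) psi (upd y j.+1 t)|].
have /choice[p hp] (i : nat) : exists p : seq nat * seq (pt * pt),
  [/\ (0 < size p.1)%N, all (leq i) p.1,
    (forall y, incube j.+1 y -> bad p.1 i.+1%:R^-1 y -> has (fun b => inbox j.+1 b y) p.2)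
    & \sum_(b <- p.2) volb j.+1 b <= 2^-1 ^+ i].
  have e0 : 0 < i.+1%:R^-1 :> R by rewrite invr_gt0.
  have v0 : 0 < 2^-1 ^+ i :> R by rewrite exprn_gt0// invr_gt0.
  have [l [l0 al [b [hb vb]]]] :=
    small_averages gdep glip gdeg irr i (ltnSn j.+1) hpsi anti sigma_ge e0 v0.
  by exists (l, b).
pose H i := seq_avg alpha g (map sigma (p i).1) psi.
have hH i : lip d (H i) by apply: lipZ; exact: (lip_sum_seq alpha glip).
have avgH i (B c : R) (u : nat -> R) : (forall a, (i <= a)%N -> `|u a - c| <= B) ->
    `|(size (map sigma (p i).1))%:R^-1 * \sum_(a <- (p i).1) u a - c| <= B.
  have [l0 al _ _] := hp i; rewrite size_map => hu.
  have sR : 0 < (size (p i).1)%:R :> R by rewrite ltr0n.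
  have -> : c = (size (p i).1)%:R^-1 * \sum_(a <- (p i).1) c.
    by rewrite big_const_seq count_predT iter_addr_0 -[c *+ _]mulr_natl mulKf// gt_eqF.
  rewrite -mulrBr -sumrB normrM ger0_norm ?invr_ge0 ?ler0n// ler_pdivrMl//.
  apply: le_trans (ler_norm_sum _ _ _) _.
  apply: le_trans (_ : \sum_(a <- (p i).1) B <= _).
    by rewrite !big_seq; apply: ler_sum => a ap; apply: hu; exact: (allP al).
  by rewrite big_const_seq count_predT iter_addr_0 mulr_natl.
have bH i y : `|H i y| <= C.
  rewrite -[H i y]subr0 /H /seq_avg big_map.
  by apply: avgH => a _; rewrite subr0; exact: bC.
pose N : set (j.+1.-tuple R) := lim_sup_set (fun i => boxes (p i).2).
have mN : measurable N.
  apply: bigcap_measurable => // m _; apply: bigcup_measurable => i _.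
  exact: measurable_boxes.
have N0 : lebesgue_null N.
  by apply: limsup_boxes_null => // i; have [] := hp i.
have mPN : measurable (@proj_init R d @^-1` N).
  by rewrite -[X in measurable X]setTI; exact: measurable_proj_init.
have mfd : measurable (~` @fund_dom R d) by apply: measurableC; exact: measurable_fund_dom.
have cvg0 : (fun i => pint mu (H i)) @ \oo --> (0 : R).
  have <- : \int[mu]_x (0 : R) = 0 by rewrite Rintegral_cst// mul0r.
  apply: (@pint_cvg _ _ mu H (fun=> 0) C) => //.
  (* Points outside the fundamental domain are discarded because [covered] only promises to catch
     points of the unit cube. *)
  exists (~` @fund_dom R d `|` @proj_init R d @^-1` N); split.
  - exact: measurableU.
  - by rewrite measureU0//; exact: muac.
  move=> x /= nx; apply: contrapT => /not_orP[/contrapT fx nN]; apply: nx.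
  have [m hm] : exists m, forall i, (m <= i)%N -> ~ boxes (p i).2 (proj_init x).
    apply: contrapT => /forallNP h; apply: nN => n _.
    by have /existsNP[i /not_implyP[ni /contrapT hb]] := h n; exists i.
  have small i : (m <= i)%N -> `|H i (coords x)| <= i.+1%:R^-1.
    move=> mi; rewrite leNgt; apply/negP => lt; apply: (hm i mi).
    have [_ _ hb _] := hp i.
    have : has (fun b => inbox j.+1 b (coords x)) (p i).2.
      apply: hb => [l lj|]; last by exists (coords x j.+1); rewrite upd_id ltW.
      have ld : (l < d)%N by rewrite ltnW.
      by rewrite (coordsE x (Ordinal ld)); exact: fx.
    rewrite /boxes /=; apply: sub_has => b /forallP h; apply/forallP => l.
    by rewrite coords_proj_init.
  apply/cvgr0Pnorm_le => e e0; exists (maxn m (Num.truncn e^-1)) => // i /=.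
  rewrite geq_max => /andP[mi ei]; apply: le_trans (small i mi) _.
  rewrite invf_ple ?posrE// ltW//; apply: lt_le_trans (_ : (Num.truncn e^-1).+1%:R <= _).
    by rewrite truncnS_gt.
  by rewrite ler_nat.
have cvgl : (fun i => pint mu (H i)) @ \oo --> pint nu psi.
  apply/cvgrPdist_le => e e0; have /cvgrPdist_le/(_ e e0)[n _ hn] := sigma_cvg hpsi.
  exists n => // i /= ni; rewrite distrC.
  have -> : pint mu (H i) = (size (map sigma (p i).1))%:R^-1 *
      \sum_(a <- (p i).1) pint mu (fun y => psi (iter (sigma a) T y)).
    rewrite /H /seq_avg pintZ; last exact: (lip_sum_seq alpha glip).
    rewrite (pint_sum_seq mu _ (F := fun a y => psi (iter a T y))) ?big_map//.
    by move=> a; exact: (lip_iter alpha glip).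
  by apply: avgH => // a ia; rewrite distrC; apply: hn; exact: leq_trans ia.
by rewrite -(cvg_lim (@Rhausdorff R) cvgl) (cvg_lim (@Rhausdorff R) cvg0).
Qed.

(** Dyadic averages differ successively by antiperiodic functions, so [nu] gives them all the same
    integral, which is that of [pmean j.+1 F]; the latter is unchanged when F is shifted. *)
Lemma pint_sh F t : lip d F -> pint nu (fun y => F (shiftc j.+1 t y)) = pint nu F.
Proof.
have red G : lip d G -> pint nu G = pint nu (pmean j.+1 G).
  move=> hG; have [L L0 hL] := hG.
  have hd i : lip d (dyad j.+1 G i) by exact: lip_dyad.
  have hm : lip d (pmean j.+1 G) by apply: (@lipW _ j.+1) => //; exact: lip_pmean.
  have eqd i : pint nu G = pint nu (dyad j.+1 G i).
    elim: i => [//|i ->]; apply/subr0_eq; rewrite -pintB//.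
    exact: pint_antiperiodic (lipB (hd i) (hd i.+1)) (dyad_antiperiodic i hG).
  apply/subr0_eq/eqP; rewrite -normr_le0; apply: (@le_arch _ _ _ L) => Q Q0; rewrite add0r.
  apply: le_trans (_ : L * 2^-1 ^+ Q <= _).
    rewrite (eqd Q) -pintB//; apply: pint_norm_le; first exact: lipB.
    by move=> y; exact: dyad_close.
  rewrite ler_wpM2l// exprVn lef_pV2 ?posrE ?exprn_gt0 ?ltr0n//.
  by rewrite -natrX ler_nat ltnW// ltn_expl.
by move=> hF; rewrite red ?(red F)// ?pmean_sh//; exact: lip_sh.
Qed.

End limit_points.

(** * The theorem, from the invariance of Lipschitz integrals *)

Unset Implicit Arguments.
Set Strict Implicit.

Theorem theorem4p1 (R : realType) (d : nat) (hd : (2 <= d)%N)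
  (alpha : R) (f : forall k : nat, k.+1.-tuple R -> R)
  (mu nu : probability (d.-tuple R) R) :
  irrational alpha ->
  (forall k : nat, (k.+1 < d)%N ->
     torus_map (f k) /\ torus_lipschitz (f k) /\
     (forall x' : k.-tuple R,
        loop_nontrivial (fun t : R => f k [tuple of rcons x' t]))) ->
  (* mu is a Borel probability measure on T^d *)
  mu (~` @fund_dom R d) = 0%E ->
  (* its projection onto T^{d-1} is absolutely continuous w.r.t. Haar *)
  (forall A : set ((d.-1).-tuple R), measurable A -> lebesgue_null A ->
     mu (@proj_init R d @^-1` A) = 0%E) ->
  (* nu is a Borel probability measure on T^d ... *)
  nu (~` @fund_dom R d) = 0%E ->
  (* ... which is a weak-* limit point of (T^n_* mu) *)
  (exists sigma : nat -> nat, {homo sigma : m n / (m < n)%N} /\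
     forall psi : d.-tuple R -> R, torus_continuous psi ->
       (fun n => (\int[pushforward mu (ssrnat.iter (sigma n) (skew_map alpha f))]_x (psi x)%:E)%E)
         @ \oo --> (\int[nu]_x (psi x)%:E)%E) ->
  forall t : R, forall A : set (d.-tuple R), measurable A ->
    nu (@rot_last R d t @^-1` A) = nu A.
Proof.
case: d hd mu nu => [//|[//|j]] _ mu nu irr hf mu0 muac nu0 [sigma [hs hcvg]] t A mA.
have glip : tri_lip j.+2 (lift_maps f).
  by apply: tri_lip_lift => k kd; have [_ []] := hf k kd.
have gdeg : tri_deg j.+2 (lift_maps f).
  by apply: tri_deg_lift => k kd; have [_ []] := hf k kd.
have sigma_ge n : (n <= sigma n)%N.
  by elim: n => [//|n IH]; apply: leq_ltn_trans IH (hs _ _ _).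
apply: (rot_last_invariant nu0) => // F s hF.
apply: (pint_sh (triangular_lift f) glip gdeg irr mu0 muac sigma_ge _ s hF) => psi hpsi.
have := hcvg _ (lip_torus_continuous hpsi); rewrite (integral_lip nu hpsi) => /fine_cvg.
rewrite (_ : _ \o _ = fun n =>
  pint mu (fun y => psi (iter (sigma n) (skewp alpha (lift_maps f)) y)))//.
by apply/funext => n /=; rewrite (integral_iter_skew_map alpha glip).
Qed.
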